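(* Let $w$ be a valuation-transcendental extension of $v$ to $K[x]$, and $f\in\mathrm{KP}(w)$. If there are exactly $r$ common extensions of $w$ and $\bar v$ to $\overline K[x]$, then $$r=\frac{\deg f^h}{j(f^h)}.$$
   Context: $(K,v)$ is a valued field of arbitrary rank, $\overline K$ a fixed algebraic closure, $\bar v$ a fixed extension of $v$ to $\overline K$, $K^h\subseteq\overline K$ the Henselization of $K$ with respect to $\bar v$, $v^h=\bar v|_{K^h}$, $\Gamma$ an ordered abelian group containing the value group of $\bar v$. A valuation on $K[x]$ extending $v$ is a map $w:K[x]\to\Gamma\cup\{\infty\}$ with $w(fg)=w(f)+w(g)$, $w(f+g)\ge\min\{w(f),w(g)\}$, restricting to $v$ on $K$. It is valuation-transcendental if $w^{-1}(\infty)=0$ and the induced valuation on $K(x)$ satisfies: $\Gamma_w/\Gamma_v$ has rational rank $1$, or $k_w|k_v$ has transcendence degree $1$. A common extension of $w$ and $\bar v$ is a valuation $\overline w$ on $\overline K[x]$ extending both. Key polynomials: $f\sim_w g$ means $w(f-g)>w(f)=w(g)$; $f\mid_w g$ means $g\sim_w fh$ for some polynomial $h$. A monic $f$ is a key polynomial for $w$ if $f\mid_w gh$ implies $f\mid_w g$ or $f\mid_w h$, and for every nonzero $g$, $f\mid_w g$ implies $\deg g\ge\deg f$. $\mathrm{KP}(w)$ is the set of key polynomials for $w$. There is a unique common extension $w^h$ of $w$ and $v^h$ to $K^h[x]$. For $f\in\mathrm{KP}(w)$, $f^h$ denotes the unique monic irreducible factor of $f$ in $K^h[x]$ such that $f^h\in\mathrm{KP}(w^h)$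 and the initial form of $f/f^h$ is a unit in the graded algebra of $w^h$, i.e. there is $g\in K^h[x]$ with $w^h\big((f/f^h)g-1\big)>0$. $j$-invariant: for $(\alpha,\delta)\in\overline K\times\Gamma$ let $\overline w_{\alpha,\delta}\big(\sum c_i(x-\alpha)^i\big)=\min_i\{\bar v(c_i)+i\delta\}$, $c_i\in\overline K$. Any common extension $\overline w$ of a valuation-transcendental $w$ and $\bar v$ is of the form $\overline w_{\alpha,\delta}$; for $f\in\overline K[x]$, $j(f)$ is the number of roots $\beta$ of $f$, counted with multiplicity, such that $\bar v(\beta-\alpha)\ge\delta$. For $f\in K^h[x]$ (in particular for $f^h$), it is independent of the choice of $\overline w$ and of $(\alpha,\delta)$. *)

(* Defs.v *)
From HB Require Import structures.
From mathcomp Require Import all_boot all_order all_algebra all_field.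
From mathcomp Require Import mpoly.
From mathcomp Require Import boolp classical_sets cardinality.
Set Implicit Arguments.
Unset Strict Implicit.
Unset Printing Implicit Defensive.
Import Order.TTheory GRing.Theory.
Local Open Scope ring_scope.
Local Open Scope quotient_scope.

HB.mixin Record isOrderedAbGroup G of Num.POrderedZmodule G := {
  oag_total : forall x y : G, (x <= y) || (y <= x);
  oag_leD2r : forall z x y : G, x <= y -> x + z <= y + z
}.
#[short(type="oagType")]
HB.structure Definition OrderedAbGroup :=
  { G of isOrderedAbGroup G & Num.POrderedZmodule G }.

Section OrderedAbGroupTheory.
Variable G : oagType.
Implicit Types x y z : G.

Lemma oag_leD x y z t : x <= y -> z <= t -> x + z <= y + t.
Proof.
move=> xy zt; apply: (le_trans (oag_leD2r z _ _ xy)).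
by rewrite ![y + _]addrC; apply: oag_leD2r.
Qed.

Lemma oag_leDr z x y : (x + z <= y + z) = (x <= y).
Proof.
by apply/idP/idP=> [/(oag_leD2r (- z))|]; [rewrite !addrK | apply: oag_leD2r].
Qed.

Lemma oag_double0 x : x + x = 0 -> x = 0.
Proof.
move=> xx; apply/eqP; rewrite eq_le.
have [x0|x0] := orP (oag_total x 0); rewrite x0 ?andbT /=.
  by rewrite -(oag_leDr x) xx add0r in x0.
by rewrite -(oag_leDr x) xx add0r in x0.
Qed.

(* [option G] stands for G with a point at infinity, [None], added on top. *)

Definition vle (a b : option G) : bool :=
  match a, b with
  | _, None => true
  | None, Some _ => false
  | Some x, Some y => x <= y
  end.

Definition vlt (a b : option G) : bool := ~~ vle b a.

Definition vmin (a b : option G) : option G := if vle a b then a else b.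

Definition vadd (a b : option G) : option G :=
  if a is Some x then if b is Some y then Some (x + y) else None else None.

Definition vsub (a b : option G) : option G :=
  if a is Some x then if b is Some y then Some (x - y) else None else None.

Lemma vle_refl a : vle a a. Proof. by case: a => /=. Qed.

Lemma vle_trans b a c : vle a b -> vle b c -> vle a c.
Proof. by case: a b c => [x|] [y|] [z|] //=; apply: le_trans. Qed.

Lemma vle_total a b : vle a b || vle b a.
Proof. by case: a b => [x|] [y|] //=; apply: oag_total. Qed.

Lemma vle_vmin a b c : vle a (vmin b c) = vle a b && vle a c.
Proof.
rewrite /vmin; case: ifP => bc.
  by apply/idP/andP => [ab|[]//]; split=> //; apply: vle_trans bc.
have cb : vle c b by have := vle_total b c; rewrite bc.
by apply/idP/andP => [ac|[]//]; split=> //; apply: vle_trans cb.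
Qed.

Lemma vlt_vmin a b c : vlt a (vmin b c) = vlt a b && vlt a c.
Proof.
rewrite /vlt /vmin; case: ifP => bc.
  apply/idP/andP => [ba|[]//]; split=> //.
  by apply: contra ba; apply: vle_trans.
have cb : vle c b by have := vle_total b c; rewrite bc.
apply/idP/andP => [ca|[]//]; split=> //.
by apply: contra ca; apply: vle_trans.
Qed.

Lemma vlt_le_trans b a c : vlt a b -> vle b c -> vlt a c.
Proof. by move=> ab bc; apply: contra ab; apply: vle_trans. Qed.

Lemma vltW a b : vlt a b -> vle a b.
Proof. by rewrite /vlt; have := vle_total a b; case: (vle b a); rewrite ?orbT ?orbF. Qed.

End OrderedAbGroupTheory.

Arguments vadd {G} a b.
Arguments vsub {G} a b.

Section Valuation.
Variable G : oagType.

Definition is_valuation (R : nzRingType) (V : R -> option G) : Prop :=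
  [/\ V 0 = None, V 1 = Some 0,
      forall a b, V (a * b) = vadd (V a) (V b)
    & forall a b, vle (vmin (V a) (V b)) (V (a + b))].

(* The support of a valuation may be nonzero; over a field it is not. *)
Record valuation (R : nzRingType) := Valuation {
  val_fun :> R -> option G;
  valuationP : is_valuation val_fun
}.

Definition trivial_support (R : nzRingType) (V : R -> option G) : Prop :=
  forall a, V a = None -> a = 0.

Definition extends (R S : Type) (phi : R -> S) (V : R -> option G)
  (W : S -> option G) : Prop := forall a, W (phi a) = V a.

Section ValuationTheory.
Variables (R : nzRingType) (V : valuation R).

Lemma val0 : V 0 = None. Proof. by case: (valuationP V). Qed.
Lemma val1 : V 1 = Some 0. Proof. by case: (valuationP V). Qed.
Lemma valM a b : V (a * b) = vadd (V a) (V b).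
Proof. by case: (valuationP V). Qed.
Lemma valD a b : vle (vmin (V a) (V b)) (V (a + b)).
Proof. by case: (valuationP V). Qed.

Lemma valN1 : V (-1) = Some 0.
Proof.
have := valM (-1) (-1); rewrite mulrNN mulr1 val1.
by case: (V (-1)) => //= x [/esym/oag_double0 ->].
Qed.

Lemma valN a : V (- a) = V a.
Proof. by rewrite -mulN1r valM valN1; case: (V a) => //= x; rewrite add0r. Qed.

Lemma valB a b : vle (vmin (V a) (V b)) (V (a - b)).
Proof. by have := valD a (- b); rewrite valN. Qed.

End ValuationTheory.

Section ValuationRing.
Variables (F : fieldType) (V : valuation F).

Definition vring_pred : {pred F} := fun a => vle (Some 0) (V a).

Lemma vring_closed : subring_closed vring_pred.
Proof.
split=> [|a b a0 b0|a b]; rewrite /in_mem /= /vring_pred.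
- by rewrite val1 vle_refl.
- by apply: vle_trans (valB V a b); rewrite vle_vmin; apply/andP.
- rewrite /in_mem /= /vring_pred valM.
  case: (V a) (V b) => [x|] [y|] //= x0 y0.
  by rewrite -[0]addr0; apply: oag_leD.
Qed.

HB.instance Definition _ := GRing.isSubringClosed.Build F vring_pred vring_closed.

Record vring := VRing { vring_val :> F; _ : vring_val \in vring_pred }.

HB.instance Definition _ := [isSub for vring_val].
HB.instance Definition _ := [Choice of vring by <:].
HB.instance Definition _ := [SubChoice_isSubComNzRing of vring by <:].

Definition vmax : {pred vring} := fun a => vlt (Some 0) (V (val a)).

Lemma vmax_closed : idealr_closed vmax.
Proof.
split; rewrite /in_mem /= /vmax.
- by rewrite rmorph0 val0.
- by rewrite rmorph1 val1 /vlt /= lexx.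
- move=> a x y; rewrite /in_mem /= /vmax => x0 y0.
  change (is_true (vlt (Some 0) (V (vring_val a * vring_val x + vring_val y)))).
  apply: vlt_le_trans (valD V _ _).
  rewrite vlt_vmin y0 andbT valM.
  have : vle (Some 0) (V (vring_val a)) by case: a.
  case: (V (vring_val a)) x0 => [s|] //; case: (V (vring_val x)) => [t|] // t0 s0.
  apply: (vlt_le_trans t0); rewrite /= -{1}[t]add0r; exact: oag_leD2r.
Qed.

HB.instance Definition _ := isIdealr.Build vring vmax vmax_closed.

Definition residue_field := {ideal_quot vmax}.
HB.instance Definition _ := GRing.ComNzRing.on residue_field.
HB.instance Definition _ := EqQuotient.on residue_field.

Lemma residue_eq0 (a : vring) : (\pi_residue_field a == 0) = (a \in vmax).
Proof.
rewrite -[a in RHS]subr0 Quotient.idealrBE; congr (_ == _).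
by rewrite [RHS](@pi_zeror _ _ _ _ _ {ideal_quot vmax}).
Qed.

Definition vring_inv (a : vring) : vring := insubd (0 : vring) (vring_val a)^-1.

Definition residue_inv (x : residue_field) : residue_field :=
  if x == 0 then 0 else \pi_residue_field (vring_inv (repr x)).

Lemma residue_mulVf x : x != 0 -> residue_inv x * x = 1.
Proof.
rewrite /residue_inv => x0; rewrite (negPf x0); move: x0.
rewrite -[in X in X -> _](reprK x) residue_eq0.
rewrite -[in X in _ * X](reprK x).
move: (repr x) => a aNm.
have va : V (val a) = Some 0.
  have : vle (Some 0) (V (val a)) by case: a {aNm}.
  move: aNm; rewrite /in_mem /= /vmax /vlt negbK.
  by case: (V (val a)) => //= s s0 s1; congr Some; apply/eqP; rewrite eq_le s0.
have a0 : val a != 0 by apply: contra_eq_neq va => ->; rewrite val0.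
have vai : V (val a)^-1 = Some 0.
  have := valM V (val a) (val a)^-1; rewrite divff // va val1.
  by case: (V _^-1) => //= t [e]; rewrite -[t]add0r -e.
rewrite -[LHS](@pi_mulr _ _ _ _ _ _ _ {ideal_quot vmax}).
have -> : vring_inv a * a = 1; last exact: (@pi_oner _ _ _ _ _ _ _ {ideal_quot vmax}).
apply: val_inj; rewrite rmorphM rmorph1 /= insubdK ?mulVf //.
by rewrite /in_mem /= /vring_pred vai vle_refl.
Qed.

Lemma residue_inv0 : residue_inv 0 = 0.
Proof. by rewrite /residue_inv eqxx. Qed.

HB.instance Definition _ :=
  GRing.ComNzRing_isField.Build residue_field residue_mulVf residue_inv0.

Definition value_group : set G := [set g | exists a, V a = Some g].

End ValuationRing.

Section ResidueMap.
Variables (F E : fieldType) (psi : F -> E) (V : valuation F) (W : valuation E).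
Hypothesis extVW : extends psi V W.

Lemma vring_mapP (a : vring V) : psi (vring_val a) \in vring_pred W.
Proof. by case: a => a va; rewrite /in_mem /= /vring_pred extVW. Qed.

Definition vring_map (a : vring V) : vring W := VRing (vring_mapP a).

Definition residue_map (x : residue_field V) : residue_field W :=
  \pi_(residue_field W) (vring_map (repr x)).

End ResidueMap.

Local Notation "x %:F" := (FracField.tofrac x).

Section FractionValuation.
Variables (R : idomainType) (w : valuation R).

Lemma vle_sub (a b : option G) z :
  vle (vsub a (Some z)) (vsub b (Some z)) = vle a b.
Proof. by case: a b => [x|] [y|] //=; rewrite oag_leDr. Qed.

Lemma vmin_sub (a b : option G) z :
  vmin (vsub a (Some z)) (vsub b (Some z)) = vsub (vmin a b) (Some z).
Proof. by rewrite /vmin vle_sub; case: ifP. Qed.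

Definition frac_val_fun (z : {fraction R}) : option G :=
  vsub (w (\n_(repr z))) (w (\d_(repr z))).

Hypothesis w0 : trivial_support w.

Lemma val_fin a : a != 0 -> exists x, w a = Some x.
Proof.
by move=> a0; case E: (w a) => [x|]; [exists x | rewrite (w0 E) eqxx in a0].
Qed.

Lemma frac_reprE (z : {fraction R}) : z * (\d_(repr z))%:F = (\n_(repr z))%:F.
Proof.
rewrite -[z in LHS]reprK; unlock FracField.tofrac.
rewrite -[LHS]FracField.pi_mul; apply/eqmodP.
rewrite /= FracField.equivfE /FracField.mulf.
rewrite !numden_Ratio ?oner_eq0 ?mulf_neq0 ?denom_ratioP ?oner_eq0 //.
by rewrite reprK !mulr1 mulrC.
Qed.

Lemma frac_val_funE (n d : R) : d != 0 ->
  frac_val_fun (n%:F / d%:F) = vsub (w n) (w d).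
Proof.
move=> d0; rewrite /frac_val_fun.
have := frac_reprE (n%:F / d%:F); move: (repr _) => s zE.
have s0 : \d_s != 0 by apply: denom_ratioP.
have : n * \d_s = \n_s * d.
  apply/eqP; rewrite -tofrac_eq !tofracM -zE [eqbRHS]mulrAC divfK //.
  by rewrite tofrac_eq0.
move/(congr1 w); rewrite !valM.
have [x ->] := val_fin d0; have [y ->] := val_fin s0.
case: (w n) (w \n_s) => [a|] [b|] //= [e]; congr Some.
by apply/eqP; rewrite subr_eq addrAC eq_sym subr_eq e.
Qed.

Lemma frac_split (z : {fraction R}) :
  exists n d, d != 0 /\ z = n%:F / d%:F.
Proof.
exists \n_(repr z), \d_(repr z); split; first exact: denom_ratioP.
by rewrite -frac_reprE mulfK // tofrac_eq0 denom_ratioP.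
Qed.

Lemma frac_valP : is_valuation frac_val_fun.
Proof.
have fE (a : R) : a%:F = a%:F / 1%:F by rewrite tofrac1 divr1.
split.
- by rewrite -tofrac0 fE frac_val_funE ?oner_eq0 // val0.
- by rewrite -tofrac1 fE frac_val_funE ?oner_eq0 // val1 /= subrr.
- move=> z t; have [n [d [d0 ->]]] := frac_split z.
  have [m [e [e0 ->]]] := frac_split t.
  rewrite mulf_div -!tofracM !frac_val_funE ?mulf_neq0 // !valM.
  have [x ->] := val_fin d0; have [y ->] := val_fin e0.
  by case: (w n) (w m) => [a|] [b|] //=; rewrite opprD addrACA.
- move=> z t; have [n [d [d0 ->]]] := frac_split z.
  have [m [e [e0 ->]]] := frac_split t.
  rewrite addf_div ?tofrac_eq0 // -!tofracM -tofracD.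
  rewrite !frac_val_funE ?mulf_neq0 //.
  have := valD w (n * e) (m * d); rewrite !valM.
  have [x ->] := val_fin d0; have [y ->] := val_fin e0.
  have subA (a : option G) z1 z2 :
      vsub a (Some z1) = vsub (vadd a (Some z2)) (Some (z1 + z2)).
    by case: a => //= a; rewrite opprD addrACA subrr addr0.
  rewrite (subA (w n) x y) (subA (w m) y x) [y + x]addrC [vadd (Some x) _]/=.
  by rewrite vmin_sub vle_sub.
Qed.

Definition frac_val : valuation {fraction R} := Valuation frac_valP.

End FractionValuation.

Definition independent_mod (n : nat) (B : set G) (t : 'I_n -> G) : Prop :=
  forall c : 'I_n -> int, B (\sum_i t i *~ c i) -> forall i, c i = 0.

(* For subgroups B <= A of G, the rational rank of A / B is n. *)
Definition rational_rank_is (A B : set G) (n : nat) : Prop :=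
  (exists t : 'I_n -> G, (forall i, A (t i)) /\ independent_mod B t) /\
  (forall t : 'I_n.+1 -> G, (forall i, A (t i)) -> ~ independent_mod B t).

Definition alg_independent (k E : fieldType) (phi : k -> E) (n : nat)
    (t : 'I_n -> E) : Prop :=
  forall p : {mpoly k[n]}, mmap phi t p = 0 -> p = 0.

Definition trdeg_is (k E : fieldType) (phi : k -> E) (n : nat) : Prop :=
  (exists t : 'I_n -> E, alg_independent phi t) /\
  (forall t : 'I_n.+1 -> E, ~ alg_independent phi t).

Definition valuation_transcendental (K : fieldType) (v : valuation K)
    (w : valuation {poly K}) : Prop :=
  exists w0 : trivial_support w,
    rational_rank_is (value_group (frac_val w0)) (value_group v) 1 \/
    exists h : extends (fun a : K => (a%:P)%:F) v (frac_val w0),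
      trdeg_is (residue_map h) 1.

Section KeyPolynomials.
Variables (F : fieldType) (w : {poly F} -> option G).

Definition w_equiv (f g : {poly F}) : Prop := vlt (w f) (w (f - g)) /\ w f = w g.

Definition w_divides (f g : {poly F}) : Prop := exists h, w_equiv g (f * h).

Definition key_polynomial (f : {poly F}) : Prop :=
  [/\ f \is monic,
      forall g h, w_divides f (g * h) -> w_divides f g \/ w_divides f h
    & forall g, g != 0 -> w_divides f g -> ((size f).-1 <= (size g).-1)%N].

(* The initial form of f in the graded algebra of w is a unit. *)
Definition initial_unit (f : {poly F}) : Prop :=
  exists g, vlt (Some 0) (w (f * g - 1)).

End KeyPolynomials.

(* W is a common extension to F[x] of w on K[x] and u on F, along phi : K -> F. *)
Definition common_extension (K F : fieldType) (phi : {rmorphism K -> F})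
    (w : valuation {poly K}) (u : F -> option G) (W : valuation {poly F}) : Prop :=
  extends (map_poly phi) w W /\ extends polyC u W.

(* L is an algebraic closure of K and vbar extends the valuation of K. The
   Henselization is the fixed field, in the separable closure of K in L, of the
   decomposition group of vbar. Restriction to the separable closure identifies
   Aut(L / K) with its Galois group, and vbar is determined by its restriction
   there, so the group is taken inside Aut(L / K). *)
Definition in_decomposition_group (K L : fieldType) (iota : {rmorphism K -> L})
    (vbar : valuation L) (s : {rmorphism L -> L}) : Prop :=
  [/\ bijective s, forall a, s (iota a) = iota a & forall z, vbar (s z) = vbar z].

Definition separable_over (K L : fieldType) (iota : {rmorphism K -> L})
    (z : L) : Prop :=
  exists p : {poly K}, separable_poly p /\ root (map_poly iota p) z.

Definition henselization (K L : fieldType) (iota : {rmorphism K -> L})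
    (vbar : valuation L) : set L :=
  [set z | separable_over iota z /\
     forall s : {rmorphism L -> L}, in_decomposition_group iota vbar s -> s z = z].

Section JInvariant.
Variables (L : closedFieldType) (vbar : valuation L).

Definition monomial_val (alpha : L) (delta : G) (f : {poly L}) : option G :=
  let c := f \Po ('X + alpha%:P) in
  \big[@vmin G/None]_(i < size c) vadd (vbar c`_i) (Some (delta *+ i)).

(* Roots of a nonzero polynomial, listed with multiplicity. *)
Definition root_seq (f : {poly L}) : seq L := sval (closed_field_poly_normal f).

Definition j_invariant (alpha : L) (delta : G) (f : {poly L}) : nat :=
  count (fun b => vle (Some delta) (vbar (b - alpha))) (root_seq f).

End JInvariant.

End Valuation.

(* Main.v *)
Require Import Defs.
From HB Require Import structures.
From mathcomp Require Import all_boot all_order all_algebra all_field.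
From mathcomp Require Import mpoly.
From mathcomp Require Import boolp classical_sets cardinality.
Set Implicit Arguments.
Unset Strict Implicit.
Unset Printing Implicit Defensive.
(* Defs is imported again because MathComp's val1, valM, ... shadow its lemmas. *)
Import Order.TTheory GRing.Theory Defs.
Local Open Scope ring_scope.
Local Open Scope classical_set_scope.

(* All common extensions are of the form wbar \o s, for s in the decomposition
   group D: isometric partial isomorphisms between subfields of L extend, by
   Zorn's lemma, because the roots of a polynomial over K[x] have the values
   prescribed by its Newton polygon, so that the value of every g(b) with b
   algebraic is also taken at some conjugate of b. Consequently D acts
   transitively on the roots of f^h, which is irreducible over the Henselization.
   For each common extension W, exactly j(f^h) roots b satisfy W(x - b) = delta,
   as D permutes the roots; and each root b belongs in this sense to exactly one
   W, because W(x - b) = delta forces W(x - z) = min(vbar(b - z), delta). Counting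
   these pairs gives r * j(f^h) = deg f^h. *)

(** The count needs every root of [fh] to belong to some common extension, and by transitivity it is
    enough that one root is within [delta] of [alpha]; this also makes j positive. Here the key
    polynomial property enters: with all roots far from [alpha] the initial form of [fh] would be a
    unit, so [fh], of positive degree, would divide 1. The Newton polygon yields, for each single
    F(x, b), a conjugate of b that depends on F. One conjugate good for all F is obtained because
    finitely many valuations can be told apart from a given one by a single element. Extension of
    isometries is needed for [vbar] on L, where it makes the embedding of the Henselization rigid,
    and for valuations on polynomial rings, where it makes the common extensions conjugate. Both are
    cases of one theorem, which allows for different supports. The Henselization is separable over
    K, while the fixed field of D in L may be purely inseparable over it. So the polynomial of a
    D-orbit descends to the Henselization only after a Frobenius power, which leaves its set of
    roots unchanged. *)

Section ExtendedValues.
Variable G : oagType.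
Implicit Types (x y : G) (a b c d : option G).

Lemma vlt_irr a : vlt a a = false.
Proof. by rewrite /vlt vle_refl. Qed.

Lemma vltNge a b : vlt a b = ~~ vle b a.
Proof. by []. Qed.

Lemma vleNgt a b : vle a b = ~~ vlt b a.
Proof. by rewrite /vlt negbK. Qed.

Lemma vle_anti a b : vle a b -> vle b a -> a = b.
Proof. by case: a b => [x|] [y|] //= xy yx; congr Some; apply: le_anti; rewrite xy. Qed.

Lemma vlt_neqAle a b : vlt a b = (a != b) && vle a b.
Proof.
apply/idP/andP => [ab|[ab ba]].
  by split; [apply: contraTneq ab => ->; rewrite vlt_irr | apply: vltW].
by apply: contra ab => /(vle_anti ba) ->.
Qed.

Lemma vlt_total a b : a != b -> vlt a b || vlt b a.
Proof. by move=> ab; rewrite !vlt_neqAle [b == a]eq_sym ab; apply: vle_total. Qed.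

Lemma vlt_fin a b : vlt a b -> exists x, a = Some x.
Proof. by case: a => [x|]; [exists x | case: b]. Qed.

Lemma vaddC a b : vadd a b = vadd b a.
Proof. by case: a b => [x|] [y|] //=; rewrite addrC. Qed.

Lemma vaddA a b c : vadd a (vadd b c) = vadd (vadd a b) c.
Proof. by case: a b c => [x|] [y|] [z|] //=; rewrite addrA. Qed.

Lemma vadd0 a : vadd (Some 0) a = a.
Proof. by case: a => //= x; rewrite add0r. Qed.

Lemma vaddN a : vadd a None = None.
Proof. by case: a. Qed.

Lemma vle_add a b c d : vle a b -> vle c d -> vle (vadd a c) (vadd b d).
Proof. by case: a b c d => [x|] [y|] [z|] [t|] //=; apply: oag_leD. Qed.

Lemma vle_addr x a b : vle (vadd a (Some x)) (vadd b (Some x)) = vle a b.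
Proof. by case: a b => [y|] [z|] //=; rewrite oag_leDr. Qed.

Lemma vlt_addr x a b : vlt (vadd a (Some x)) (vadd b (Some x)) = vlt a b.
Proof. by rewrite !vltNge vle_addr. Qed.

Lemma vlt_le_add a b c d x :
  vlt a b -> vle c d -> c = Some x -> vlt (vadd a c) (vadd b d).
Proof.
move=> ab cd cx; apply: (@vlt_le_trans _ (vadd b c)); first by rewrite cx vlt_addr.
by apply: vle_add => //; apply: vle_refl.
Qed.

Lemma oag_mulrn_gt0 x n : 0 < x -> 0 < x *+ n.+1.
Proof.
move=> x0; elim: n => // n; rewrite [x *+ n.+2]mulrS; set y := x *+ _.
rewrite !lt_neqAle => /andP[y0 le_y]; have le_x := ltW x0.
have : x <= x + y by rewrite -{1}[x]addr0; apply: oag_leD.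
move=> xy; rewrite (le_trans le_x xy) andbT; apply: contraTneq x0 => e.
by rewrite le_gtF // e.
Qed.

Lemma oag_mulrn_eq0 x n : x *+ n.+1 = 0 -> x = 0.
Proof.
move=> xn; apply: contra_eq xn => x0.
have [xp|xn] := orP (oag_total 0 x).
  have := @oag_mulrn_gt0 x n; rewrite !lt_neqAle xp eq_sym x0 => /(_ isT).
  by rewrite eq_sym => /andP[].
have np : 0 <= - x by have := oag_leD2r (- x) _ _ xn; rewrite subrr add0r.
have := @oag_mulrn_gt0 (- x) n.
rewrite !lt_neqAle np eq_sym oppr_eq0 x0 => /(_ isT).
by rewrite eq_sym mulNrn oppr_eq0 => /andP[].
Qed.

End ExtendedValues.

Section ValuationSums.
Variables (G : oagType) (R : nzRingType) (V : valuation G R).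

Lemma val_exp (a : R) n : V (a ^+ n) = iter n (vadd (V a)) (Some 0).
Proof.
elim: n => [|n IHn]; first by rewrite expr0 val1.
by rewrite exprS valM IHn.
Qed.

Lemma val_sum_gt (I : Type) (s : seq I) (P : pred I) (F : I -> R) g :
  (forall i, P i -> vlt (Some g) (V (F i))) ->
  vlt (Some g) (V (\sum_(i <- s | P i) F i)).
Proof.
move=> gF; elim/big_ind: _ => [|a b ga gb|//]; first by rewrite val0.
by apply: vlt_le_trans (valD V a b); rewrite vlt_vmin ga.
Qed.

Lemma valD_lt a b : vlt (V a) (V b) -> V (a + b) = V a.
Proof.
move=> ab; apply: vle_anti; last first.
  by apply: vle_trans (valD V a b); rewrite vle_vmin vle_refl vltW.
have := valD V (a + b) (- b); rewrite addrK valN /vmin; case: ifP => //.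
by move=> _ ba; move: ab; rewrite vltNge ba.
Qed.

End ValuationSums.

(** * Newton polygons and the values of roots *)

Section RootValue.
Variable G : oagType.

(** This is the value of the [k]-th term of [P] at an argument of value [g]. As [g] may be infinite,
    the argument 0 needs no separate case. *)
Definition newton_weight (R : nzRingType) (V : valuation G R) (g : option G)
    (P : {poly R}) k : option G :=
  vadd (V P`_k) (iter k (vadd g) (Some 0)).

(* The Newton polygon has an edge of slope [- g] only if some root has value [g]. *)
Lemma newton_vertex (R : comNzRingType) (V : valuation G R) (g : option G)
    (bs : seq R) : all (fun b => V b != g) bs ->
  let T := newton_weight V g (\prod_(b <- bs) ('X - b%:P)) in
  exists m x, T m = Some x /\ forall k, k != m -> vlt (Some x) (T k).
Proof.
elim: bs => [_|b bs IHbs /=].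
  exists 0%N, 0; split; first by rewrite /newton_weight big_nil coef1 val1 /= addr0.
  by case=> // k _; rewrite /newton_weight big_nil coef1 val0.
case/andP=> bg /IHbs[m [x]] /=.
set Q := \prod_(b <- bs) _; set T := newton_weight V g Q => -[Tm Tk].
have Tle k : vle (Some x) (T k).
  by have [->|/Tk/vltW//] := eqVneq k m; rewrite -Tm vle_refl.
rewrite big_cons -/Q; set T' := newton_weight V g _.
have T0 : T' 0%N = vadd (V b) (T 0%N).
  by rewrite /T' /T /newton_weight /= mulrBl coefB coefXM mul_polyC coefZ sub0r valN valM -vaddA.
have coefS k : (('X - b%:P) * Q)`_k.+1 = Q`_k - b * Q`_k.+1.
  by rewrite mulrBl coefB coefXM mul_polyC coefZ.
have E1 k : vadd (V Q`_k) (iter k.+1 (vadd g) (Some 0)) = vadd g (T k).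
  by rewrite /T /newton_weight /= vaddA [vadd _ g]vaddC vaddA.
have E2 k : vadd (V (b * Q`_k.+1)) (iter k.+1 (vadd g) (Some 0)) = vadd (V b) (T k.+1).
  by rewrite valM /T /newton_weight -vaddA.
have TS k u : vlt u (vadd g (T k)) -> vlt u (vadd (V b) (T k.+1)) -> vlt u (T' k.+1).
  rewrite -E1 -E2 /T' /newton_weight coefS; set i := iter _ _ _ => u1 u2.
  have := valB V Q`_k (b * Q`_k.+1); rewrite /vmin; case: ifP => _ le_u.
    by apply: vlt_le_trans u1 _; apply: vle_add => //; apply: vle_refl.
  by apply: vlt_le_trans u2 _; apply: vle_add => //; apply: vle_refl.
(* At an argument of value [g] one term of X - b dominates: b if [V b] is below [g], and the unique
   minimum stays at [m]; otherwise X, and it moves to [m.+1]. *)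
have [gb|gb] := orP (vlt_total bg).
- have [y by_] := vlt_fin gb; exists m, (y + x).
  have step k : vle (T m) (T k) -> vlt (Some (y + x)) (vadd g (T k)).
    move=> mk; rewrite -[Some _]/(vadd (Some y) (Some x)) -by_.
    by apply: (vlt_le_add (x := x)); rewrite // -Tm.
  split.
    case: m Tm {Tk} step => [|m] Tm step; first by rewrite T0 Tm by_.
    have := step m; rewrite Tm => /(_ (Tle m)).
    rewrite -[Some (y + x)]/(vadd (Some y) (Some x)) -by_ -Tm -E1 -E2.
    set i := iter _ _ _ => lt_i; rewrite /T' /newton_weight coefS -/i addrC.
    rewrite valD_lt valN // vltNge; apply: contraL lt_i => le_i.
    by rewrite -vleNgt; apply: vle_add => //; apply: vle_refl.
  case=> [|k] km.
    rewrite T0 by_ -[Some (y + x)]/(vadd (Some y) (Some x)).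
    by rewrite ![vadd (Some y) _]vaddC vlt_addr Tk.
  apply: TS; first by apply: step; rewrite Tm.
  rewrite by_ -[Some (y + x)]/(vadd (Some y) (Some x)) ![vadd (Some y) _]vaddC.
  by rewrite vlt_addr Tk.
- have [y gy] := vlt_fin gb; exists m.+1, (y + x).
  have step k : vlt (Some (y + x)) (vadd (V b) (T k)).
    rewrite -[Some _]/(vadd (Some y) (Some x)) -gy.
    by apply: (vlt_le_add (x := x)).
  split.
    have := step m.+1.
    rewrite -[Some (y + x)]/(vadd (Some y) (Some x)) -gy -Tm -E1 -E2.
    set i := iter _ _ _ => lt_i; rewrite /T' /newton_weight coefS -/i.
    rewrite valD_lt // valN vltNge; apply: contraL lt_i => le_i.
    by rewrite -vleNgt; apply: vle_add => //; apply: vle_refl.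
  case=> [|k]; first by rewrite T0.
  rewrite eqSS => km; apply: TS => //.
  rewrite gy -[Some (y + x)]/(vadd (Some y) (Some x)) ![vadd (Some y) _]vaddC.
  by rewrite vlt_addr Tk.
Qed.

(** The terms of [P] at [a] cancel, so their least value cannot be attained at one index only. Just
    the values of the coefficients enter, so the [b] may live in another ring with another
    valuation. *)
Lemma root_value (R S : comNzRingType) (V : valuation G R) (W : valuation G S)
    (P : {poly R}) (a : R) (bs : seq S) :
  root P a ->
  (forall k, V P`_k = W (\prod_(b <- bs) ('X - b%:P))`_k) ->
  exists2 b, b \in bs & W b = V a.
Proof.
move=> /rootP Pa PW; apply: contrapT => noB.
have allB : all (fun b => W b != V a) bs.
  by apply/allP=> b bB; apply/eqP=> bv; apply: noB; exists b.
have [m [x [Tm Tk]]] := newton_vertex allB.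
have lt_m : (m < size P)%N.
  rewrite ltnNge; apply/negP=> le_m.
  by move: Tm; rewrite /newton_weight -PW nth_default // val0.
move: Pa; rewrite horner_coef (bigD1 (Ordinal lt_m)) //=.
move/eqP; rewrite addr_eq0 => /eqP/(congr1 V); rewrite valN valM val_exp PW.
rewrite [vadd _ _]Tm.
move=> e; suff : vlt (Some x) (Some x) by rewrite vlt_irr.
rewrite {2}e; apply: val_sum_gt => i im; rewrite valM val_exp PW.
exact: Tk.
Qed.

End RootValue.

(** * Symmetric functions of the roots *)

Lemma mmap_mesym (A B : comNzRingType) (phi : {rmorphism A -> B}) n (h : 'I_n -> B) k :
  mmap phi h (mesym n A k) = (mesym n B k).@[h].
Proof.
rewrite !rmorph_sum /=; apply: eq_bigr => m _.
by rewrite !rmorph_prod /=; apply: eq_bigr => i _; rewrite mmapX mevalXU mmap1U.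
Qed.

Lemma mmap_comp_mpoly (A B : comNzRingType) (phi : {rmorphism A -> B}) n k
    (h : 'I_k -> B) (q : n.-tuple {mpoly A[k]}) (t : {mpoly A[n]}) :
  mmap phi h (t \mPo q) = mmap phi (fun i => mmap phi h (tnth q i)) t.
Proof.
rewrite comp_mpolyE rmorph_sum /=; apply: eq_bigr => m _.
rewrite mmapZ rmorph_prod; congr (_ * _); apply: eq_bigr => i _.
by rewrite rmorphXn.
Qed.

Lemma rmorph_meval (A B : comNzRingType) (phi : {rmorphism A -> B}) n
    (h : 'I_n -> A) (t : {mpoly A[n]}) :
  phi t.@[h] = mmap phi (phi \o h) t.
Proof.
rewrite mevalE rmorph_sum; apply: eq_bigr => m _.
rewrite rmorphM rmorph_prod; congr (_ * _); apply: eq_bigr => i _.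
by rewrite rmorphXn.
Qed.

(** The product of the X - F(X_i) has coefficients symmetric in the X_i, hence polynomial in the
    elementary symmetric functions, for which the coefficients of [p] are substituted. One [P]
    serves all [phi], so it can be factored over two unrelated fields. *)
Lemma norm_exists (A : comNzRingType) (p F : {poly A}) : p \is monic ->
  exists P : {poly A}, forall (B : idomainType) (phi : {rmorphism A -> B}) (bs : seq B),
    map_poly phi p = \prod_(b <- bs) ('X - b%:P) ->
    map_poly phi P = \prod_(b <- bs) ('X - ((map_poly phi F).[b])%:P).
Proof.
move=> mon_p; pose n := (size p).-1.
pose FX i := (map_poly (@mpolyC n A) F).['X_i].
pose Q := \prod_(i < n) ('X - (FX i)%:P).
have symQ k : Q`_k \is symmetric.
  apply/issymP=> s; rewrite -coef_map; congr ((polyseq _)`_k).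
  rewrite rmorph_prod /= /Q [RHS](reindex_inj (@perm.perm_inj _ s)) /=.
  apply: eq_bigr => i _; rewrite rmorphB /= map_polyX map_polyC; congr (_ - _%:P).
  rewrite /FX -[LHS]horner_map /= -map_poly_comp; congr _.[_].
    by apply: eq_map_poly => a; apply: mmapC.
  by rewrite [LHS]mmapX mmap1U.
have [t tE] := choice (fun k => let: exist t (conj e _) := sym_fundamental (symQ k) in
  ex_intro (fun t => t \mPo _ = Q`_k) t e).
(* By Vieta this is the elementary symmetric function of degree [i.+1]; indices in ['I_n] start at
   0. *)
pose s (i : 'I_n) := (-1) ^+ i.+1 * p`_(n - i.+1).
exists (\poly_(k < n.+1) (t k).@[s]) => B phi bs pE.
have size_bs : size bs == n.
  have := size_prod_XsubC bs id; rewrite -pE => e.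
  have : size (map_poly phi p) = size p.
    by apply: size_map_poly_id0; rewrite (monicP mon_p) rmorph1 oner_eq0.
  by rewrite e /n => <-.
pose cs := Tuple size_bs; have -> : bs = cs by [].
have mapQ : map_poly (mmap phi (tnth cs)) Q
    = \prod_(b <- cs) ('X - ((map_poly phi F).[b])%:P).
  rewrite rmorph_prod big_tuple; apply: eq_bigr => i _.
  rewrite rmorphB /= map_polyX map_polyC; congr (_ - _%:P).
  rewrite /FX -[LHS]horner_map /= -map_poly_comp; congr _.[_].
    by apply: eq_map_poly => a /=; rewrite mmapC.
  by rewrite mmapX mmap1U.
rewrite -mapQ; apply/polyP=> k; rewrite !coef_map coef_poly.
case: ltnP => [_|kn]; last first.
  rewrite raddf0 [Q`_k]nth_default ?raddf0 //.
  by rewrite size_prod_XsubC /index_enum -enumT size_enum_ord.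
rewrite -tE /= mmap_comp_mpoly rmorph_meval; congr (mmap phi _ _).
apply/funext=> i /=; rewrite tnth_mktuple mmap_mesym.
have := mroots_coeff cs (inord i.+1).
rewrite inordK ?ltnS // -[\prod_(c <- cs) _]/(\prod_(c <- bs) _) -pE coef_map /=.
by rewrite /s rmorphM rmorphXn rmorphN1 => ->; rewrite mulrA -exprMn mulrNN mulr1 expr1n mul1r.
Qed.

(** * Separation of finitely many valuations *)

Section SeparateValues.
Variable G : oagType.

(** An ordered group is torsion-free, so each nonzero pair (d, e) has at most one [n] with
    [d *+ n + e = 0]. *)
Lemma eventually_mulrnD_neq0 (s : seq (G * G)) : all (fun de => de != 0) s ->
  exists N, forall n, (N <= n)%N -> all (fun de => de.1 *+ n + de.2 != 0) s.
Proof.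
elim: s => [|[d e] s IHs] /=; first by exists 0%N.
case/andP=> de /IHs[N HN].
suff [N' HN'] : exists N', forall n, (N' <= n)%N -> d *+ n + e != 0.
  by exists (maxn N N') => n; rewrite geq_max => /andP[/HN -> /HN' ->].
case: (pselect (exists n, d *+ n + e = 0)) => [[n0 n0P]|noN]; last first.
  by exists 0%N => n _; apply/eqP=> ne; apply: noN; exists n.
exists n0.+1 => n lt_n; apply/eqP=> nP.
have /oag_mulrn_eq0 d0 : d *+ (n - n0).-1.+1 = 0.
  rewrite prednK ?subn_gt0 // mulrnBr; last exact: ltnW.
  by rewrite -(subrr 0) -{1}nP -{1}n0P opprD addrACA subrr addr0.
move: n0P; rewrite d0 mul0rn add0r => e0.
by move: de; rewrite d0 e0 eqxx.
Qed.

Lemma val_expSome (R : nzRingType) (V : valuation G R) a x n :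
  V a = Some x -> V (a ^+ n) = Some (x *+ n).
Proof.
move=> ax; elim: n => [|n IHn]; first by rewrite expr0 val1.
by rewrite exprS valM IHn ax mulrS.
Qed.

(* If [a] separates [V] from some valuations and [b] from another one, then so
   does [a ^+ n * b] for large [n] from all of them. *)
Lemma separate_valuations (R : nzRingType) (V : valuation G R) (I : eqType)
    (U : I -> valuation G R) (s : seq I) :
  (forall i, i \in s -> forall a, V a = None <-> U i a = None) ->
  (forall i, i \in s -> exists a, V a <> U i a) ->
  exists a, V a <> None /\ forall i, i \in s -> V a <> U i a.
Proof.
elim: s => [_ _|i s IHs suppU sepU]; first by exists 1; rewrite val1.
have [||a [aN sep_a]] := IHs.
- by move=> j js; apply: suppU; rewrite inE js orbT.
- by move=> j js; apply: sepU; rewrite inE js orbT.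
have [b bi] := sepU i (mem_head i s).
have bN : V b <> None by move=> e; apply: bi; rewrite e; apply/esym/(suppU i (mem_head i s)).
pose fin (g : option G) := odflt 0 g.
have finV c : V c <> None -> V c = Some (fin (V c)) by case: (V c).
have finU c j : j \in i :: s -> V c <> None -> U j c = Some (fin (U j c)).
  by move=> js; rewrite (suppU j js); case: (U j c).
(* [N] times the first entry plus the second is the difference of the two values of [a ^+ N * b].
   The pair is nonzero: [b] separates [i], and [a] separates the others. *)
pose de j := (fin (V a) - fin (U j a), fin (V b) - fin (U j b)).
have [|N /(_ N (leqnn N))/allP HN] := @eventually_mulrnD_neq0 (map de (i :: s)).
  apply/allP=> _ /mapP[j js ->]; apply/eqP=> -[/eqP e1 /eqP e2].
  move: e1 e2; rewrite !subr_eq0 => /eqP e1 /eqP e2.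
  move: js; rewrite inE => /orP[/eqP ji|js].
    by apply: bi; rewrite (finV b bN) (finU b i (mem_head i s) bN) e2 ji.
  have js' : j \in i :: s by rewrite inE js orbT.
  by apply: (sep_a j js); rewrite (finV a aN) (finU a j js' aN) e1.
exists (a ^+ N * b); rewrite valM (val_expSome _ (finV a aN)) (finV b bN).
split=> // j js; rewrite valM (val_expSome _ (finU a j js aN)) (finU b j js bN).
case=> e; have /negP[] := HN _ (map_f de js); rewrite /= mulrnBl addrACA -opprD.
by rewrite subr_eq0 e.
Qed.

Lemma comp_valuationP (R S : nzRingType) (V : valuation G S) (phi : {rmorphism R -> S}) :
  is_valuation (V \o phi).
Proof.
split=> [||a b|a b] /=; first by rewrite rmorph0 val0.
- by rewrite rmorph1 val1.
- by rewrite rmorphM valM.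
- by rewrite rmorphD valD.
Qed.

Definition comp_valuation (R S : nzRingType) (V : valuation G S)
    (phi : {rmorphism R -> S}) : valuation G R :=
  Valuation (comp_valuationP V phi).

End SeparateValues.

(** * Values at an algebraic element and at its conjugates *)

Lemma minimal_poly_exists (k M : fieldType) (g : {rmorphism k -> M}) (b : M) :
  algebraicOver g b ->
  exists p : {poly k}, [/\ p \is monic, irreducible_poly p
    & forall q, root (map_poly g q) b = (p %| q)].
Proof.
case=> q0 q0_nz q0b.
pose P n := `[< exists q : {poly k}, [/\ q != 0, size q = n & root (map_poly g q) b] >].
have exP : exists n, P n by exists (size q0); apply/asboolP; exists q0.
have [n /asboolP[q [q_nz size_q qb]] min_n] := find_ex_minn exP.
pose p := (lead_coef q)^-1 *: q.
have lc : lead_coef q != 0 by rewrite lead_coef_eq0.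
have p_nz : p != 0 by rewrite scaler_eq0 invr_eq0 negb_or lc.
have size_p : size p = n by rewrite size_scale ?invr_eq0.
have pb : root (map_poly g p) b by rewrite /root map_polyZ hornerZ (rootP qb) mulr0.
have dvd_p r : root (map_poly g r) b = (p %| r).
  apply/idP/idP => [rb|/dvdpP[s ->]]; last by rewrite rmorphM rootM pb orbT.
  apply/contraT => /eqP r_nz.
  have : root (map_poly g (r %% p)) b.
    by move: rb; rewrite {1}(divp_eq r p) /root rmorphD rmorphM !hornerE (rootP pb) mulr0 add0r.
  move=> rpb; have /min_n : P (size (r %% p)).
    by apply/asboolP; exists (r %% p); split=> //; apply/eqP.
  by rewrite leqNgt -size_p ltn_modp p_nz.
exists p; split=> //; first by rewrite monicE lead_coefZ mulVf.
split=> [|r size_r dvd_r].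
  rewrite ltnNge; apply/negP=> /size1_polyC pC; move: pb p_nz; rewrite pC map_polyC.
  by rewrite rootC fmorph_eq0 polyC_eq0 => ->.
rewrite /eqp dvd_r -dvd_p /=; apply: contraTT size_r => rb; rewrite negbK.
have /dvdpP[s ps] := dvd_r; have := pb; rewrite ps rmorphM rootM (negPf rb) orbF dvd_p.
move/dvdp_leq; have := p_nz; rewrite ps mulf_eq0 negb_or => /andP[s_nz r_nz].
move=> /(_ s_nz); rewrite size_mul // leqNgt => le_s.
by move: le_s; rewrite (polySpred r_nz) addnS /= -{1}[size s]addn0 ltn_add2l -eqn0Ngt.
Qed.

(** An element of A[x][Y] is specialised at Y = b, and x stays the variable. Thus valuations on
    A(b)[x] and A(c)[x] can be compared on one ring. *)
Definition bivariate_eval (A F : comNzRingType) (g : {rmorphism A -> F}) (b : F) :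
    {poly {poly A}} -> {poly F} :=
  horner_eval b%:P \o map_poly (map_poly g).

HB.instance Definition _ (A F : comNzRingType) (g : {rmorphism A -> F}) (b : F) :=
  GRing.RMorphism.on (bivariate_eval g b).

Lemma bivariate_evalC (A F : comNzRingType) (g : {rmorphism A -> F}) (b : F) p :
  bivariate_eval g b p%:P = map_poly g p.
Proof. by rewrite /bivariate_eval /= map_polyC /horner_eval /= hornerC. Qed.

Lemma bivariate_eval_polyC (A F : comNzRingType) (g : {rmorphism A -> F}) (b : F) p :
  bivariate_eval g b (map_poly polyC p) = (map_poly g p).[b]%:P.
Proof.
rewrite /bivariate_eval /horner_eval /= -map_poly_comp.
rewrite (eq_map_poly (g := polyC \o g)) => [|a /=]; last by rewrite map_polyC.
by rewrite map_poly_comp horner_map.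
Qed.

Lemma coef_bivariate_eval (A F : comNzRingType) (g : {rmorphism A -> F}) (b : F) P i :
  (bivariate_eval g b P)`_i = (map_poly g (map_poly (coefp i) P)).[b].
Proof.
rewrite /bivariate_eval /horner_eval /=.
rewrite (@horner_coef_wide _ (size P)) ?size_poly // coef_sum.
rewrite (@horner_coef_wide _ (size P)); last first.
  by apply: leq_trans (size_poly _ _) (size_poly _ _).
apply: eq_bigr => k _; rewrite !coef_map -rmorphXn coefMC coef_map.
by rewrite coef_map_id0 // coef0.
Qed.

Definition bivariate_valuation (G : oagType) (A F : comNzRingType)
    (g : {rmorphism A -> F}) (b : F) (W : valuation G {poly F}) :
    valuation G {poly {poly A}} :=
  @comp_valuation G {poly {poly A}} {poly F} W (bivariate_eval g b).

Section ConjugateValue.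
Variables (G : oagType) (k M : fieldType) (L L' : closedFieldType).
Variables (iM : {rmorphism k -> M}) (iL : {rmorphism k -> L}) (j : {rmorphism M -> L'}).
Variables (W2 : valuation G {poly M}) (W1 : valuation G {poly L}).

(* Each support consists of the polynomials whose coefficients of index in [N]
   vanish. With N = {0}, this covers the valuations f |-> v (f.[0]); with
   N = setT, those of trivial support. *)
Variable N : set nat.
Hypothesis supp2 : forall f, W2 f = None <-> forall i, N i -> f`_i = 0.
Hypothesis supp1 : forall f, W1 f = None <-> forall i, N i -> f`_i = 0.
Hypothesis agree : forall f, W2 (map_poly iM f) = W1 (map_poly iL f).

(** The candidates for [c] are the roots in [L] of the minimal polynomial of [b]. If all failed, a
    single [F] would refute them all; but F(x, b) is a root of a polynomial over k[x] whose roots on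
    the side of [L] are the F(x, c), and its coefficients have equal values on both sides. *)
Lemma extend_one (b : M) : algebraicOver iM b ->
  exists c : L, forall F, W2 (bivariate_eval iM b F) = W1 (bivariate_eval iL c F).
Proof.
move=> /minimal_poly_exists[p [mon_p irr_p root_p]].
have [cs] := closed_field_poly_normal (map_poly iL p).
rewrite lead_coef_map (monicP mon_p) rmorph1 scale1r => p_cs.
have root_cs c q : c \in cs -> root (map_poly iL q) c = (p %| q).
  move=> cs_c; have pc : root (map_poly iL p) c by rewrite p_cs root_prod_XsubC.
  apply/idP/idP => [qc|/dvdpP[s ->]]; last by rewrite rmorphM rootM pc orbT.
  apply: contraLR qc; rewrite -irreducible_poly_coprime // => cop.
  by apply: coprimep_root pc; rewrite coprimep_map.
apply: contrapT => noc.
pose V := bivariate_valuation iM b W2.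
pose U c := bivariate_valuation iL c W1.
have [F [_ sepF]] : exists F, V F <> None /\ forall c, c \in cs -> V F <> U c F.
  apply: (separate_valuations (R := {poly {poly k}})).
    move=> c cs_c F; rewrite /V /U /= supp2 supp1.
    split=> F0 i /F0/eqP; rewrite !coef_bivariate_eval => F0i; apply/eqP.
      by rewrite -[_ == 0]/(root _ _) root_cs // -root_p.
    by rewrite -[_ == 0]/(root _ _) root_p -(root_cs c).
  move=> c cs_c; apply: contrapT => noF; apply: noc; exists c => F.
  by apply: contrapT => neq; apply: noF; exists F.
have [P normP] : exists P : {poly {poly k}},
    forall (B : idomainType) (phi : {rmorphism {poly k} -> B}) (bs : seq B),
    map_poly phi (map_poly polyC p) = \prod_(b <- bs) ('X - b%:P) ->
    map_poly phi P = \prod_(b <- bs) ('X - ((map_poly phi F).[b])%:P).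
  by apply: norm_exists; rewrite map_monic.
have normL := normP {poly L} (map_poly iL) (map polyC cs).
have normL' := normP {poly L'} (map_poly (j \o iM)).
have [cs'] := closed_field_poly_normal (map_poly (j \o iM) p).
rewrite lead_coef_map (monicP mon_p) rmorph1 scale1r => p_cs'.
have lift (B : fieldType) (g : {rmorphism k -> B}) (s : seq B) :
    map_poly g p = \prod_(b <- s) ('X - b%:P) ->
    map_poly (map_poly g) (map_poly polyC p) = \prod_(b <- map polyC s) ('X - b%:P).
  move=> ps; rewrite -map_poly_comp.
  rewrite (eq_map_poly (g := polyC \o g)) => [|a /=]; last by rewrite map_polyC.
  rewrite map_poly_comp ps rmorph_prod big_map; apply: eq_bigr => i _.
  by rewrite rmorphB /= map_polyX map_polyC.
have {}normL := normL (lift _ _ _ p_cs).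
have {}normL' := normL' _ (lift _ _ _ p_cs').
(* [M] need not split [p], so the factorisation of [P] is read over [L'] and the root is pulled back
   along the injective [j]. *)
have rootP2 : root (map_poly (map_poly iM) P) (bivariate_eval iM b F).
  have cs'b : j b \in cs'.
    rewrite -root_prod_XsubC -p_cs' map_poly_comp fmorph_root.
    by rewrite root_p.
  have : root (map_poly (map_poly (j \o iM)) P) (bivariate_eval (j \o iM) (j b) F).
    rewrite normL' big_map (big_rem _ cs'b) /= rootM root_XsubC.
    by rewrite /bivariate_eval /horner_eval /= eqxx.
  rewrite (eq_map_poly (map_poly_comp _ _))
    [X in root _ X](_ : _ = map_poly j (bivariate_eval iM b F)).
    rewrite map_poly_comp /root horner_map /= => /eqP e.
    by apply/eqP/(map_poly_inj j); rewrite e rmorph0.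
  by apply/polyP=> i; rewrite coef_map !coef_bivariate_eval (map_poly_comp j) horner_map.
have [|_ /mapP[c cs_c ->] Wc] := root_value (V := W2) (W := W1)
  (bs := [seq bivariate_eval iL c F | c <- cs]) rootP2.
  move=> i; rewrite coef_map /= agree big_map.
  rewrite -[map_poly iL _]coef_map normL big_map.
  by [].
by apply: (sepF c cs_c).
Qed.

End ConjugateValue.

(** * Extension of isometries by Zorn's lemma *)

Section SubfieldOfProduct.
Variables (M L : fieldType) (A : set (M * L)).

Hypotheses (A1 : A 1) (AB : forall x y, A x -> A y -> A (x - y))
  (AM : forall x y, A x -> A y -> A (x * y))
  (AV : forall x, A x -> x != 0 -> exists2 y, A y & y * x = 1).

Definition rel_pred : {pred M * L} := fun x => `[< A x >].

Lemma rel_subring_closed : subring_closed rel_pred.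
Proof.
split=> [|x y /asboolP Ax /asboolP Ay|x y /asboolP Ax /asboolP Ay]; apply/asboolP => //.
  exact: AB.
exact: AM.
Qed.

HB.instance Definition _ := GRing.isSubringClosed.Build (M * L)%type rel_pred rel_subring_closed.

Record rel_field := RelField { rel_val :> M * L; _ : rel_val \in rel_pred }.

HB.instance Definition _ := [isSub for rel_val].
HB.instance Definition _ := [Choice of rel_field by <:].
HB.instance Definition _ := [SubChoice_isSubComNzRing of rel_field by <:].

Lemma rel_inv_exists (x : rel_field) :
  exists y : rel_field, (x != 0 -> y * x = 1) /\ (x = 0 -> y = 0).
Proof.
have [->|x0] := eqVneq x 0; first by exists 0.
have /asboolP Ax : val x \in rel_pred by apply: valP.
have [|y Ay yx] := AV Ax.
  by apply: contraNneq x0 => e; apply/eqP/val_inj; exact: e.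
have Ay' : y \in rel_pred by apply/asboolP.
by exists (RelField Ay'); split=> [_|e]; [apply: val_inj | rewrite e eqxx in x0].
Qed.

Definition rel_inv x := sval (cid (rel_inv_exists x)).

Lemma rel_mulVf x : x != 0 -> rel_inv x * x = 1.
Proof. by rewrite /rel_inv; case: cid => y [/= yx _] /yx. Qed.

Lemma rel_inv0 : rel_inv 0 = 0.
Proof. by rewrite /rel_inv; case: cid => y [/= _ y0]; apply: y0. Qed.

HB.instance Definition _ := GRing.ComNzRing_isField.Build rel_field rel_mulVf rel_inv0.

(** The graph of a partial isomorphism is itself made a field, embedded by its two projections; it
    then serves as the base field of the next extension step. *)
Lemma subfield_of_product :
  exists (F : fieldType) (g : {rmorphism F -> M}) (h : {rmorphism F -> L}),
  forall x, A x <-> exists z, x = (g z, h z).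
Proof.
pose g : {rmorphism rel_field -> M} := fst \o val.
pose h : {rmorphism rel_field -> L} := snd \o val.
refine (ex_intro _ (rel_field : fieldType) (ex_intro _ g (ex_intro _ h _))) => x.
split=> [Ax|[z ->]].
  have Ax' : x \in rel_pred by apply/asboolP.
  by exists (RelField Ax'); rewrite /g /h /=; case: (x).
have /asboolP Az : val z \in rel_pred by apply: valP.
by rewrite /g /h /= -surjective_pairing.
Qed.

End SubfieldOfProduct.

Lemma inverse_horner (k M : fieldType) (g : {rmorphism k -> M}) (a : M) :
  algebraicOver g a -> a != 0 -> exists r : {poly k}, (map_poly g r).[a] * a = 1.
Proof.
case/minimal_poly_exists=> p [_ irr_p root_p] a0.
have cop : coprimep p 'X.
  by rewrite irreducible_poly_coprime // -root_p map_polyX rootX.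
have /Bezout_eq1_coprimepP[[u v] /= /(congr1 (fun q => (map_poly g q).[a]))] := cop.
rewrite rmorphD !rmorphM rmorph1 /= map_polyX !hornerE.
have /rootP-> : root (map_poly g p) a by rewrite root_p.
by rewrite mulr0 add0r => e; exists v.
Qed.

Section ConjugateExtension.
Variables (G : oagType) (k M : fieldType) (L L' : closedFieldType).
Variables (iM : {rmorphism k -> M}) (iL : {rmorphism k -> L}) (j : {rmorphism M -> L'}).
Hypothesis algM : forall b : M, algebraicOver iM b.
Variables (W2 : valuation G {poly M}) (W1 : valuation G {poly L}).
Variable N : set nat.
Hypothesis N0 : N 0%N.
Hypothesis supp2 : forall f, W2 f = None <-> forall i, N i -> f`_i = 0.
Hypothesis supp1 : forall f, W1 f = None <-> forall i, N i -> f`_i = 0.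
Hypothesis agree : forall f, W2 (map_poly iM f) = W1 (map_poly iL f).

(** Graphs of isomorphisms over [k] between subfields. Values are compared on polynomials with
    corresponding coefficients; that the relation is functional, injective and closed under inverses
    is derived below. *)
Definition partial_isometry (A : set (M * L)) : Prop :=
  [/\ forall a, A (iM a, iL a),
      forall x y, A x -> A y -> A (x - y),
      forall x y, A x -> A y -> A (x * y)
    & forall (f : {poly M}) (h : {poly L}), (forall i, A (f`_i, h`_i)) -> W2 f = W1 h].

Section PartialIsometry.
Variable A : set (M * L).
Hypothesis isoA : partial_isometry A.

Lemma pisoC a : A (iM a, iL a). Proof. by case: isoA. Qed.
Lemma pisoB x y : A x -> A y -> A (x - y). Proof. by case: isoA => _ AB _ _; apply: AB. Qed.
Lemma pisoM x y : A x -> A y -> A (x * y). Proof. by case: isoA => _ _ AM _; apply: AM. Qed.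
Lemma pisoW (f : {poly M}) (h : {poly L}) : (forall i, A (f`_i, h`_i)) -> W2 f = W1 h.
Proof. by case: isoA => _ _ _; apply. Qed.

Lemma piso0 : A 0. Proof. by have := pisoC 0; rewrite !rmorph0. Qed.
Lemma piso1 : A 1. Proof. by have := pisoC 1; rewrite !rmorph1. Qed.
Lemma pisoD x y : A x -> A y -> A (x + y).
Proof. by move=> Ax Ay; rewrite -[y]opprK -[- y]add0r; apply/pisoB/pisoB/Ay/piso0. Qed.

(** Since 0 lies in [N], a constant polynomial of infinite value vanishes, on either side. *)
Lemma piso_eq0 x : A x -> (x.1 == 0) = (x.2 == 0).
Proof.
move=> Ax; have e : W2 x.1%:P = W1 x.2%:P.
  by apply: pisoW => -[|i]; rewrite !coefC /=; [case: (x) Ax | apply: piso0].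
apply/eqP/eqP=> x0.
  have /supp1/(_ 0%N N0) : W1 x.2%:P = None by rewrite -e x0 val0.
  by rewrite coefC.
have /supp2/(_ 0%N N0) : W2 x.1%:P = None by rewrite e x0 val0.
by rewrite coefC.
Qed.

Lemma piso_horner x (r : {poly k}) : A x -> A ((map_poly iM r).[x.1], (map_poly iL r).[x.2]).
Proof.
move=> Ax; elim/poly_ind: r => [|r c IHr].
  by rewrite !rmorph0 !horner0; apply: piso0.
rewrite !rmorphD !rmorphM /= !map_polyX !map_polyC !hornerE.
exact: (pisoD (pisoM IHr Ax) (pisoC c)).
Qed.

(** [x.1] is algebraic over [k], so its inverse is a polynomial in it, and ring operations already
    reach it. *)
Lemma piso_inv x : A x -> x != 0 -> exists2 y, A y & y * x = 1.
Proof.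
move=> Ax x0; have x10 : x.1 != 0.
  apply: contraNneq x0 => e; have := piso_eq0 Ax; rewrite e eqxx => /esym/eqP e2.
  by apply/eqP; case: (x) e e2 => a b /= -> ->.
have [r rE] := inverse_horner (algM x.1) x10.
have Ar := piso_horner r Ax; eexists; first exact: Ar.
have := piso_eq0 (pisoB (pisoM Ar Ax) piso1); rewrite /= rE subrr eqxx.
by move/esym/eqP/subr0_eq => r2; case: (x) rE r2 => a b /= e1 e2; congr pair.
Qed.

Lemma piso_extend (b : M) : exists2 B, partial_isometry B & A `<=` B /\ exists c, B (b, c).
Proof.
have [F [gM [gL AE]]] := subfield_of_product piso1 pisoB pisoM piso_inv.
have algF : algebraicOver gM b.
  have [p p_nz pb] := algM b.
  have [s sE] := choice (fun a : k => (AE (iM a, iL a)).1 (pisoC a)).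
  pose q := \poly_(i < size p) s p`_i.
  have qE : map_poly gM q = map_poly iM p.
    apply/polyP=> i; rewrite !coef_map coef_poly; case: ltnP => [_|le_i].
      by have [/esym] := sE p`_i.
    by rewrite nth_default // !raddf0.
  exists q; last by rewrite qE.
  by apply: contra_neq p_nz => q0; apply: (map_poly_inj iM); rewrite -qE q0 !rmorph0.
have agreeF (f : {poly F}) : W2 (map_poly gM f) = W1 (map_poly gL f).
  by apply: pisoW => i; rewrite !coef_map; apply/AE; exists f`_i.
have [c Wc] := extend_one j supp2 supp1 agreeF algF.
pose B : set (M * L) := [set x | exists q, x = ((map_poly gM q).[b], (map_poly gL q).[c])].
have AB : A `<=` B.
  by move=> x /AE[z ->]; exists z%:P; rewrite !map_polyC !hornerC.
exists B; last first.
  by split=> //; exists c, 'X; rewrite !map_polyX !hornerX.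
split=> [a|x y [p ->] [q ->]|x y [p ->] [q ->]|f h].
- exact/AB/pisoC.
- by exists (p - q); rewrite !rmorphB !hornerE.
- by exists (p * q); rewrite !rmorphM !hornerE.
move=> /choice[q qE].
pose n := maxn (size f) (size h).
(* The coefficients of [f] and [h] are q_i(b) and q_i(c) with common q_i, so the sum of the q_i(Y)
   x^i specialises to both. *)
pose P : {poly {poly F}} := \sum_(i < n) map_poly polyC (q i) * ('X^i)%:P.
have evP (R : fieldType) (g : {rmorphism F -> R}) (z : R) (e : {poly R}) :
    (size e <= n)%N -> (forall i, e`_i = (map_poly g (q i)).[z]) -> bivariate_eval g z P = e.
  move=> size_e eE; rewrite rmorph_sum; apply/polyP=> i; rewrite coef_sum.
  under eq_bigr => l _ do rewrite rmorphM /= bivariate_evalC bivariate_eval_polyC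
    map_polyXn -eE coefCM coefXn.
  have [lt_i|le_i] := ltnP i n; last first.
    rewrite [RHS]nth_default ?(leq_trans size_e) // big1 // => l _.
    by rewrite gtn_eqF ?mulr0 // (leq_trans (ltn_ord l)).
  rewrite (bigD1 (Ordinal lt_i)) //= eqxx mulr1 big1 ?addr0 // => l ne_l.
  by rewrite (_ : _ == _ = false) ?mulr0 //; apply: contraNF ne_l => /eqP e_l; apply/eqP/val_inj.
have -> : f = bivariate_eval gM b P.
  by apply/esym/evP; rewrite ?leq_maxl // => i; have [] := qE i.
rewrite Wc; congr (W1 _); apply: evP; rewrite ?leq_maxr // => i.
by have [] := qE i.
Qed.

End PartialIsometry.

Lemma partial_isometry_base : partial_isometry (range (fun a => (iM a, iL a))).
Proof.
split=> [a|x y [a _ <-] [b _ <-]|x y [a _ <-] [b _ <-]|f h fh].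
- by exists a.
- by exists (a - b); rewrite // !rmorphB.
- by exists (a * b); rewrite // !rmorphM.
have /choice[a aE] i : exists a, (iM a, iL a) = (f`_i, h`_i).
  by have [a _ ?] := fh i; exists a.
pose q := \poly_(i < maxn (size f) (size h)) a i.
have qE (R : fieldType) (g : {rmorphism k -> R}) (e : {poly R}) :
    (size e <= maxn (size f) (size h))%N -> (forall i, e`_i = g (a i)) -> map_poly g q = e.
  move=> size_e eE; apply/polyP=> i; rewrite coef_map coef_poly eE.
  by case: ltnP => // le_i; rewrite -eE raddf0 nth_default // (leq_trans size_e).
rewrite -(qE _ iM f) ?leq_maxl => [||i]; last by have [/esym] := aE i.
  by rewrite -(qE _ iL h) ?leq_maxr => [||i] //; have [_ /esym] := aE i.
by [].
Qed.

(** Polynomials have finitely many coefficients, so the condition on values can be checked inside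
    one member of the chain. *)
Lemma chain_finite (F : set (set (M * L))) (n : nat) (u : nat -> M * L) :
  total_on F subset -> F !=set0 -> (forall i, (i < n)%N -> (\bigcup_(X in F) X) (u i)) ->
  exists2 X, F X & forall i, (i < n)%N -> X (u i).
Proof.
move=> totF [X0 FX0]; elim: n => [_|n IHn uF]; first by exists X0.
have [X FX Xu] := IHn (fun i lt_i => uF i (ltnW lt_i)).
have [Y FY Yu] := uF n (ltnSn n).
have [XY|YX] := totF X Y FX FY.
  by exists Y => // i; rewrite ltnS leq_eqVlt => /orP[/eqP->//|/Xu/XY].
by exists X => // i; rewrite ltnS leq_eqVlt => /orP[/eqP->|/Xu//]; apply: YX.
Qed.

Lemma partial_isometry_bigcup (F : set (set (M * L))) :
  F `<=` partial_isometry -> total_on F subset -> F !=set0 ->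
  partial_isometry (\bigcup_(X in F) X).
Proof.
move=> isoF totF F0; have [X0 FX0] := F0.
have common x y : (\bigcup_(X in F) X) x -> (\bigcup_(X in F) X) y ->
    exists2 X, F X & X x /\ X y.
  move=> [X FX Xx] [Y FY Yy]; have [XY|YX] := totF X Y FX FY.
    by exists Y => //; split=> //; apply: XY.
  by exists X => //; split=> //; apply: YX.
split=> [a|x y Fx Fy|x y Fx Fy|f h fh].
- by exists X0 => //; apply: pisoC (isoF _ FX0) a.
- have [X FX [Xx Xy]] := common x y Fx Fy.
  by exists X => //; apply: pisoB (isoF _ FX) _ _ Xx Xy.
- have [X FX [Xx Xy]] := common x y Fx Fy.
  by exists X => //; apply: pisoM (isoF _ FX) _ _ Xx Xy.
have [X FX Xfh] := chain_finite (n := maxn (size f) (size h)) totF F0 (fun i _ => fh i).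
apply: (pisoW (isoF _ FX)) => i; have [/Xfh//|] := ltnP i (maxn (size f) (size h)).
rewrite geq_max => /andP[fi hi]; rewrite !nth_default //.
exact: piso0 (isoF _ FX).
Qed.

Theorem conjugate_extension : exists2 s : {rmorphism M -> L},
  s \o iM =1 iL & forall f, W2 f = W1 (map_poly s f).
Proof.
pose P : set (set (M * L)) := [set X | X = set0 \/ partial_isometry X].
have [|A [[A0|isoA] maxA]] := @Zorn_bigcup _ P.
- move=> F FP totF; pose F' := F `&` [set X | X !=set0].
  have bigF : \bigcup_(X in F) X = \bigcup_(X in F') X.
    apply/seteqP; split=> x [X FX Xx]; last by exists X => //; case: FX.
    by exists X => //; split=> //; exists x.
  have [F'0|/set0P F'0] := eqVneq F' set0.
    by left; rewrite bigF F'0 bigcup_set0.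
  right; rewrite bigF; apply: partial_isometry_bigcup => // [X|X Y].
    by move=> [/FP[-> [x []]|//]].
  by move=> [FX _] [FY _]; apply: totF.
- case: (maxA (range (fun a => (iM a, iL a)))); last by right; apply: partial_isometry_base.
  rewrite A0 properEneq; split=> //; apply/eqP => e.
  by have : set0 (iM 0, iL 0); [rewrite e; exists 0|].
have /choice[s As] b : exists c, A (b, c).
  have [B isoB [AB [c Bc]]] := piso_extend isoA b.
  exists c; apply: contrapT => nAc; apply: (maxA B); last by right.
  by split=> // BA; apply/nAc/BA.
have funA x c : A (x, c) -> c = s x.
  move=> Ac; have := pisoB isoA Ac (As x); move/(piso_eq0 isoA); rewrite /= subrr eqxx.
  by move/esym/eqP/subr0_eq.
have sB : zmod_morphism s.
  by move=> x y; apply/esym/funA; apply: (pisoB isoA (As x) (As y)).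
have sM : monoid_morphism s.
  split; first by apply/esym/funA; apply: piso1 isoA.
  by move=> x y; apply/esym/funA; apply: (pisoM isoA (As x) (As y)).
pose m1 := GRing.isZmodMorphism.Build M L s sB.
pose m2 := GRing.isMonoidMorphism.Build M L s sM.
pose sR : {rmorphism M -> L} := HB.pack s m1 m2.
exists sR => [a|f] /=; first by apply/esym/funA/(pisoC isoA).
by apply: (pisoW isoA) => i; rewrite (coef_map sR); apply: As.
Qed.
End ConjugateExtension.

Lemma val_field_eqN (G : oagType) (F : fieldType) (V : valuation G F) a :
  V a = None <-> a = 0.
Proof.
split=> [Va|->]; last exact: val0.
apply: contra_eq Va => a0; have := valM V a a^-1.
by rewrite divff // val1; case: (V a).
Qed.

Definition constant_valuation (G : oagType) (F : fieldType) (V : valuation G F) :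
    valuation G {poly F} :=
  @comp_valuation G {poly F} F V (horner_eval 0).

Lemma constant_valuationE (G : oagType) (F : fieldType) (V : valuation G F) f :
  constant_valuation V f = V f`_0.
Proof. by rewrite /= /horner_eval horner_coef0. Qed.

(** This is [conjugate_extension] for valuations that see only the constant coefficient, with [N]
    reduced to 0. *)
Lemma extend_isometry (G : oagType) (k : fieldType) (L : closedFieldType)
    (V : valuation G L) (g h : {rmorphism k -> L}) :
  (forall z, algebraicOver g z) -> (forall a, V (g a) = V (h a)) ->
  exists2 s : {rmorphism L -> L}, s \o g =1 h & forall z, V (s z) = V z.
Proof.
move=> alg_g gh.
have supp f : constant_valuation V f = None <-> forall i, [set 0%N] i -> f`_i = 0.
  rewrite constant_valuationE val_field_eqN; split=> [f0 i ->//|]; exact.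
have agree f : constant_valuation V (map_poly g f) = constant_valuation V (map_poly h f).
  by rewrite !constant_valuationE !coef_map gh.
have zero0 : [set 0%N] 0%N by [].
have [s sg sV] := conjugate_extension (idfun : {rmorphism L -> L}) alg_g zero0 supp supp agree.
exists s => // z; have := sV z%:P.
by rewrite !constant_valuationE coef_map coefC => ->.
Qed.

(** * Algebraic endomorphisms and inseparability *)

Lemma perm_map_stable (T : eqType) (s : T -> T) (rs : seq T) :
  injective s -> uniq rs -> {subset map s rs <= rs} -> perm_eq (map s rs) rs.
Proof.
move=> inj_s uniq_rs sub; have uniq_s : uniq (map s rs) by rewrite map_inj_uniq.
by apply: uniq_perm => //; have [] := uniq_min_size uniq_s sub; rewrite ?size_map.
Qed.

Lemma rmorph_alg_bijective (K : fieldType) (L : closedFieldType)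
    (iota : {rmorphism K -> L}) (s : {rmorphism L -> L}) :
  (forall z, algebraicOver iota z) -> s \o iota =1 iota -> bijective s.
Proof.
move=> alg_i si; have inj_s : injective s by apply: fmorph_inj.
suff /choice[t ts] : forall y, exists x, s x = y.
  by exists t => // x; apply: inj_s; rewrite ts.
move=> y; have [p p_nz py] := alg_i y.
have q_nz : map_poly iota p != 0 by rewrite map_poly_eq0.
have [rs p_rs] := closed_field_poly_normal (map_poly iota p).
have rsE x : (x \in undup rs) = root (map_poly iota p) x.
  by rewrite p_rs rootZ ?lead_coef_eq0 // root_prod_XsubC mem_undup.
have sub : {subset map s (undup rs) <= undup rs}.
  move=> _ /mapP[x + ->]; rewrite !rsE => /(rmorph_root s).
  by rewrite -map_poly_comp (eq_map_poly si).
have := perm_mem (perm_map_stable inj_s (undup_uniq rs) sub) y.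
by rewrite rsE py => /mapP[x _ ->]; exists x.
Qed.

(** If the minimal polynomial has derivative 0, it is a polynomial g in X^r with r the
    characteristic, and g, of smaller degree, vanishes at z^r. In characteristic 0 the condition on
    [q] means [q = 1]. *)
Lemma separable_power (K L : fieldType) (iota : {rmorphism K -> L}) (z : L) :
  algebraicOver iota z ->
  exists2 q, [pchar L].-nat q & separable_over iota (z ^+ q).
Proof.
case/minimal_poly_exists=> p [mon_p irr_p root_p].
have [n] := ubnP (size p); elim: n => // n IHn in z p mon_p irr_p root_p *.
rewrite ltnS => size_p.
have [p'0|p'_nz] := eqVneq p^`() 0; last first.
  exists 1%N => //; exists p; split; last by rewrite expr1 root_p.
  rewrite unlock irreducible_poly_coprime //.
  by apply/negP=> /(dvdp_leq p'_nz); rewrite leqNgt lt_size_deriv ?monic_neq0.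
(* The top coefficient of the derivative of the monic [p] is its degree, which therefore vanishes in
   [K]. *)
have [r r_char] : exists r, r \in [pchar K].
  apply: (@natf0_pchar _ (size p).-1); first by case: irr_p; case: (size p) => [|[]].
  have := congr1 (fun f : {poly K} => f`_(size p).-2) p'0.
  rewrite coef0 coef_deriv -mulr_natr => /eqP.
  have -> : (size p).-2.+1 = (size p).-1 by case: irr_p; case: (size p) => [|[]].
  by rewrite -[p`_ _]/(lead_coef p) (monicP mon_p) mul1r.
have r_pr := pcharf_prime r_char.
have r_charL : r \in [pchar L] by rewrite (fmorph_pchar iota).
pose g := \poly_(i < ((size p).-1 %/ r).+1) p`_(i * r).
have r_gt1 := prime_gt1 r_pr; have r_gt0 := prime_gt0 r_pr.
have size_p1 : (1 < size p)%N by case: irr_p.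
have pE : p = g \Po 'X^r.
  apply/polyP=> i; rewrite coef_comp_poly_Xn //; case: ifPn => [r_i|r_i].
    rewrite coef_poly divnK //; case: ltnP => // lt_i.
    rewrite nth_default // leqNgt; apply: contraTN lt_i => lt_i.
    by rewrite -ltnNge ltnS leq_div2r // -ltnS prednK // ltnW.
  case: i r_i => [|i r_i]; first by rewrite dvdn0.
  have := congr1 (fun f : {poly K} => f`_i) p'0.
  rewrite coef0 coef_deriv -mulr_natr => /eqP.
  by rewrite mulf_eq0 -(dvdn_pcharf r_char) (negPf r_i) orbF => /eqP.
have g_nz : g != 0 by apply: contraTneq size_p1 => g0; rewrite pE g0 comp_poly0 size_poly0.
have gz : root (map_poly iota g) (z ^+ r).
  have := dvdpp p; rewrite -root_p {1}pE map_comp_poly map_polyXn /root horner_comp hornerXn.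
  by [].
have [p2 [mon_p2 irr_p2 root_p2]] : exists p2 : {poly K}, [/\ p2 \is monic, irreducible_poly p2
    & forall q, root (map_poly iota q) (z ^+ r) = (p2 %| q)].
  by apply: minimal_poly_exists; exists g.
have [|q q_char q_sep] := IHn (z ^+ r) p2 mon_p2 irr_p2 root_p2.
  have : (size p2 <= size g)%N by rewrite dvdp_leq // -root_p2.
  move/leq_ltn_trans; apply; apply: leq_trans size_p.
  apply: leq_ltn_trans (size_poly _ _) _.
  rewrite -ltn_predRL ltn_Pdiv // -ltnS prednK //.
  exact: ltnW.
exists (r * q)%N; last by rewrite exprM.
by rewrite pnatM q_char andbT pnatE.
Qed.

(** * The decomposition group and the Henselization *)

Section Decomposition.
Variables (G : oagType) (K : fieldType) (L : closedFieldType) (iota : {rmorphism K -> L}).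
Hypothesis algL : forall z : L, algebraicOver iota z.
Variable vbar : valuation G L.
Local Notation D := (in_decomposition_group iota vbar).

Lemma decomposition1 : D (idfun : {rmorphism L -> L}).
Proof. by split=> //; exists id. Qed.

Lemma decompositionM (s t : {rmorphism L -> L}) : D s -> D t -> D (s \o t).
Proof.
case=> bs si sv [bt ti tv]; split=> [|a|z] /=; first exact: bij_comp.
  by rewrite ti si.
by rewrite sv tv.
Qed.

Lemma isometry_decomposition (s : {rmorphism L -> L}) :
  s \o iota =1 iota -> (forall z, vbar (s z) = vbar z) -> D s.
Proof. by move=> si sv; split=> //; apply: rmorph_alg_bijective si. Qed.

Variables (Kh : fieldType) (ih : {rmorphism K -> Kh}) (jh : {rmorphism Kh -> L}).
Hypothesis jh_ih : jh \o ih =1 iota.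
Hypothesis im_jh : range jh = henselization iota vbar.

Lemma decomposition_fix (s : {rmorphism L -> L}) a : D s -> s (jh a) = jh a.
Proof.
have : range jh (jh a) by exists a.
by rewrite im_jh => -[_]; apply.
Qed.

Lemma algebraic_henselization z : algebraicOver jh z.
Proof.
have [p p_nz pz] := algL z; exists (map_poly ih p).
  by apply: contra_neq p_nz => e; apply: (map_poly_inj ih); rewrite e rmorph0.
by rewrite -map_poly_comp (eq_map_poly jh_ih).
Qed.

(** Such an embedding extends to an element of [D], which fixes the Henselization pointwise. *)
Lemma henselization_embedding (s : {rmorphism Kh -> L}) :
  s \o ih =1 iota -> (forall a, vbar (s a) = vbar (jh a)) -> s =1 jh.
Proof.
move=> si sv.
have [t tj tv] := extend_isometry algebraic_henselization (fun a => esym (sv a)).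
have Dt : D t.
  apply: isometry_decomposition tv => a /=.
  by rewrite -[X in t X]jh_ih; apply: etrans (tj (ih a)) (si a).
by move=> a; rewrite -(tj a) /= decomposition_fix.
Qed.

Lemma fixed_power z : (forall s, D s -> s z = z) ->
  exists2 q, [pchar L].-nat q & range jh (z ^+ q).
Proof.
move=> fix_z; have [q q_char q_sep] := separable_power (algL z).
exists q => //; rewrite im_jh; split=> // s Ds.
by rewrite rmorphXn fix_z.
Qed.

Lemma fixed_common_power n (c : nat -> L) : (forall i s, D s -> s (c i) = c i) ->
  exists2 q, [pchar L].-nat q & forall i, (i < n)%N -> range jh (c i ^+ q).
Proof.
move=> fix_c; elim: n => [|n [q q_char qc]]; first by exists 1%N.
have [q' q'_char [a _ aE]] := fixed_power (fix_c n).
exists (q * q')%N; first by rewrite pnatM q_char.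
move=> i; rewrite ltnS leq_eqVlt => /orP[/eqP->|/qc[b _ bE]].
  by exists (a ^+ q); rewrite // rmorphXn aE -exprM mulnC.
by exists (b ^+ q'); rewrite // rmorphXn bE -exprM.
Qed.

(** [q] is a power of the characteristic exponent that brings all coefficients into the
    Henselization; raising to it is additive, so Q(x)^q is the sum of the Q_i^q (x^q)^i. *)
Lemma fixed_poly_power (Q : {poly L}) : (forall s, D s -> map_poly s Q = Q) ->
  exists q (h : {poly Kh}), (0 < q)%N /\ forall x, (map_poly jh h).[x] = Q.[x] ^+ q.
Proof.
move=> fixQ; have fixQi i (s : {rmorphism L -> L}) : D s -> s Q`_i = Q`_i.
  by move=> Ds; rewrite -coef_map fixQ.
have [q q_char qQ] := fixed_common_power (size Q) fixQi.
have q_gt0 : (0 < q)%N by case/andP: q_char.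
have /choice[a aE] i : exists a, jh a = Q`_i ^+ q.
  have [/qQ[a _ <-]|le_i] := ltnP i (size Q); first by exists a.
  by exists 0; rewrite rmorph0 nth_default // expr0n gtn_eqF.
exists q, ((\poly_(i < size Q) a i) \Po 'X^q); split=> // x.
rewrite map_comp_poly map_polyXn horner_comp hornerXn.
rewrite (@horner_coef_wide _ (size Q)); last first.
  by apply: leq_trans (size_poly _ _) (size_poly _ _).
rewrite [in RHS]horner_coef.
have -> : (\sum_(i < size Q) Q`_i * x ^+ i) ^+ q = \sum_(i < size Q) (Q`_i * x ^+ i) ^+ q.
  apply: (big_morph (fun y : L => y ^+ q)) => [y z|]; first exact: exprDn_pchar.
  by rewrite expr0n gtn_eqF.
by apply: eq_bigr => i _; rewrite coef_map coef_poly ltn_ord /= aE exprMn exprAC.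
Qed.

(** The orbit of [b] is finite and its polynomial is fixed by [D], so some polynomial over [Kh] has
    exactly the orbit as its roots. It vanishes at [b], hence at [b']. *)
Lemma decomposition_transitive (b b' : L) :
  (forall q, root (map_poly jh q) b -> root (map_poly jh q) b') ->
  exists2 s, D s & s b = b'.
Proof.
move=> bb'; have [p p_nz pb] := algL b.
have [rs] := closed_field_poly_normal (map_poly iota p).
have lc_nz : lead_coef (map_poly iota p) != 0 by rewrite lead_coef_map fmorph_eq0 lead_coef_eq0.
move=> p_rs; have rsE x : root (map_poly iota p) x = (x \in rs).
  by rewrite p_rs rootZ // root_prod_XsubC.
pose O := undup [seq x <- rs | `[< exists2 s, D s & s b = x >]].
have memO x : x \in O <-> exists2 s, D s & s b = x.
  rewrite mem_undup mem_filter; split=> [/andP[/asboolP]//|[s Ds sb]].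
  apply/andP; split; first by apply/asboolP; exists s.
  rewrite -rsE -sb; case: Ds => _ si _.
  have -> : map_poly iota p = map_poly s (map_poly iota p).
    by rewrite -map_poly_comp; apply: eq_map_poly => a /=; rewrite si.
  by rewrite fmorph_root.
have fixO (s : {rmorphism L -> L}) : D s ->
    map_poly s (\prod_(x <- O) ('X - x%:P)) = \prod_(x <- O) ('X - x%:P).
  move=> Ds; rewrite rmorph_prod.
  under eq_bigr do rewrite rmorphB /= map_polyX map_polyC.
  rewrite -(big_map s xpredT (fun x => 'X - x%:P)) /=; apply: perm_big.
  have sub : {subset map s O <= O}.
    move=> _ /mapP[x /memO[t Dt <-] ->]; apply/memO.
    by exists (s \o t); first exact: decompositionM.
  by apply: perm_map_stable => //; [apply: fmorph_inj | apply: undup_uniq].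
have [q [h [q_gt0 hE]]] := fixed_poly_power fixO.
have rootO x : root (map_poly jh h) x = (x \in O).
  by rewrite /root hE expf_eq0 q_gt0 -[_ == 0]/(root _ _) root_prod_XsubC.
apply/memO; rewrite -rootO; apply: bb'; rewrite rootO; apply/memO.
by exists idfun; first exact: decomposition1.
Qed.

End Decomposition.

(** * Supports, linear factors and initial units *)

Section PolynomialValuations.
Variable G : oagType.

Lemma vmin_lel (a b : option G) : vle (vmin a b) a.
Proof. by have := vle_refl (vmin a b); rewrite vle_vmin => /andP[]. Qed.

Lemma vmin_ler (a b : option G) : vle (vmin a b) b.
Proof. by have := vle_refl (vmin a b); rewrite vle_vmin => /andP[]. Qed.

Lemma val_distC (R : nzRingType) (V : valuation G R) a b : V (a - b) = V (b - a).
Proof. by rewrite -valN opprB. Qed.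

(** Every point of an ultrametric ball is a centre of it. *)
Lemma vmin_recenter (R : nzRingType) (V : valuation G R) a b z d :
  vle d (V (a - b)) -> vmin (V (a - z)) d = vmin (V (b - z)) d.
Proof.
have half a' b' : vle d (V (a' - b')) -> vle (vmin (V (a' - z)) d) (vmin (V (b' - z)) d).
  move=> dab; rewrite vle_vmin vmin_ler andbT.
  have -> : b' - z = (b' - a') + (a' - z) by rewrite addrA subrK.
  apply: vle_trans (valD V _ _); rewrite vle_vmin vmin_lel andbT (val_distC V b').
  exact: vle_trans (vmin_ler _ _) dab.
by move=> dab; apply: vle_anti; apply: half => //; rewrite (val_distC V b).
Qed.

Lemma valuation_ext (R : nzRingType) (V W : valuation G R) : V =1 W -> V = W.
Proof.
case: V W => V VP [W WP] /= VW; have VWe : V = W by apply/funext.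
by subst W; congr Valuation; apply: Prop_irrelevance.
Qed.

Lemma valuation_linear_ext (L : closedFieldType) (V W : valuation G {poly L}) :
  (forall a, V a%:P = W a%:P) -> (forall z, V ('X - z%:P) = W ('X - z%:P)) -> V = W.
Proof.
move=> VWC VWX; apply: valuation_ext => f.
have [rs ->] := closed_field_poly_normal f; rewrite -mul_polyC !valM VWC; congr vadd.
by elim: rs => [|z rs IHrs]; rewrite ?big_nil ?val1 // !big_cons !valM VWX IHrs.
Qed.

(** The witness is a product of polynomials over [K], one vanishing at each root of [f]. It carries
    the triviality of the support from [w] to its extensions. *)
Lemma dvdp_map_algebraic (K M : fieldType) (L : closedFieldType) (iM : {rmorphism K -> M})
    (j : {rmorphism M -> L}) (f : {poly M}) :
  (forall z, algebraicOver (j \o iM) z) -> f != 0 ->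
  exists2 P : {poly K}, P != 0 & f %| map_poly iM P.
Proof.
move=> algL f_nz; have [rs f_rs] := closed_field_poly_normal (map_poly j f).
suff [P P_nz PE] : exists2 P : {poly K}, P != 0 &
    \prod_(z <- rs) ('X - z%:P) %| map_poly (j \o iM) P.
  exists P => //; rewrite -(dvdp_map j) f_rs -map_poly_comp dvdpZl //.
  by rewrite lead_coef_eq0 map_poly_eq0.
elim: rs {f_rs} => [|z rs [P P_nz PE]]; first by exists 1; rewrite ?oner_eq0 // big_nil dvd1p.
have [p p_nz pz] := algL z; exists (p * P); first exact: mulf_neq0.
by rewrite big_cons rmorphM dvdp_mul // dvdp_XsubCl.
Qed.

Lemma trivial_support_algebraic (K M : fieldType) (L : closedFieldType)
    (iM : {rmorphism K -> M}) (j : {rmorphism M -> L})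
    (w : valuation G {poly K}) (W : valuation G {poly M}) :
  (forall z, algebraicOver (j \o iM) z) -> trivial_support w ->
  extends (map_poly iM) w W -> trivial_support W.
Proof.
move=> algL w0 wW f Wf; apply: contra_eq Wf => f_nz.
have [P P_nz /dvdpP[q PE]] := dvdp_map_algebraic algL f_nz.
have : w P <> None by move=> /w0 P0; rewrite P0 eqxx in P_nz.
by rewrite -wW PE valM => wP; apply/eqP => fN; apply: wP; rewrite fN vaddN.
Qed.

Lemma trivial_support_coef (F : fieldType) (W : valuation G {poly F}) : trivial_support W ->
  forall f, W f = None <-> forall i, [set: nat] i -> f`_i = 0.
Proof.
move=> W0 f; split=> [/W0-> i _|f0]; first by rewrite coef0.
by rewrite (_ : f = 0) ?val0 //; apply/polyP=> i; rewrite coef0 f0.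
Qed.

End PolynomialValuations.

Section InitialUnits.
Variables (G : oagType) (F : fieldType) (w : valuation G {poly F}).

(** An inverse of the initial form makes [f] divide 1, against the minimality of its degree. *)
Lemma key_polynomial_not_unit (f : {poly F}) :
  (1 < size f)%N -> key_polynomial w f -> ~ initial_unit w f.
Proof.
move=> size_f [_ _ min_f] [g fg]; have : ((size f).-1 <= (size (1%R : {poly F})).-1)%N.
  apply: min_f; first exact: oner_neq0.
  exists g; split; first by rewrite val1 val_distC.
  by rewrite -[f * g](subrK 1) addrC valD_lt // val1.
by rewrite size_poly1 /= leqn0; case: (size f) size_f => [|[]].
Qed.

(* If f satisfies a polynomial [q * 'X + c] up to terms of value larger than
   that of c, then [- q(f) / c] is an inverse of f in the graded algebra. *)
Lemma initial_unit_of_root (f m : {poly F}) :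
  vlt (w (m.[0])%:P) (w (m \Po f)) -> initial_unit w f.
Proof.
elim/poly_ind: m => [|q c _]; first by rewrite horner0 comp_poly0 val0.
rewrite !hornerE comp_polyD comp_polyM comp_polyX comp_polyC => lt_c.
have [x cx] := vlt_fin lt_c.
have c0 : c != 0 by apply: contra_eqN cx => /eqP ->; rewrite val0.
have [y cy] : exists y, w (c^-1)%:P = Some y.
  have := valM w c%:P (c^-1)%:P; rewrite -polyCM divff // val1 cx.
  by case: (w _) => [y _|//]; exists y.
exists (- (q \Po f) * (c^-1)%:P).
have -> : f * (- (q \Po f) * (c^-1)%:P) - 1 = - (((q \Po f) * f + c%:P) * (c^-1)%:P).
  rewrite mulrDl -polyCM divff // mulrA mulrN mulNr -opprD; congr (- (_ * _ + _)).
  exact: mulrC.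
(* Writing 1 as c c^-1 lets the value of c^-1 cancel, which leaves [lt_c]. *)
rewrite valN valM cy -(val1 w) -[1 in X in vlt X _](_ : c%:P * (c^-1)%:P = _); last first.
  by rewrite -polyCM divff.
by rewrite valM cy vlt_addr.
Qed.

End InitialUnits.

(** * Monomial valuations and far roots *)

Section MonomialValuation.
Variables (G : oagType) (L : closedFieldType) (vbar : valuation G L).
Variables (wbar : valuation G {poly L}) (alpha : L) (delta : G).
Hypothesis wbarE : wbar =1 monomial_val vbar alpha delta.

Lemma monomial_val_XsubC z :
  wbar ('X - z%:P) = vmin (vbar (alpha - z)) (Some delta).
Proof.
rewrite wbarE /monomial_val rmorphB /= comp_polyX comp_polyC -addrA -polyCB.
rewrite size_XaddC !big_ord_recl big_ord0 /= !coefD !coefX !coefC /=.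
rewrite add0r addr0 mulr0n mulr1n val1 vaddC !vadd0 /=.
by rewrite /vmin; case: (vbar _).
Qed.

(** [delta] is the largest value of a monic linear polynomial, and it is attained at the points
    counted by j. *)
Lemma monomial_val_XsubC_eq z :
  (wbar ('X - z%:P) == Some delta) = vle (Some delta) (vbar (z - alpha)).
Proof.
rewrite monomial_val_XsubC val_distC /vmin; case: ifP => [le_d|].
  apply/eqP/idP => [->|d_le]; first exact: vle_refl.
  exact: vle_anti.
by rewrite eqxx; have := vle_total (vbar (z - alpha)) (Some delta) => /orP[->|->].
Qed.

(** In X - b = (X - alpha) + (alpha - b) the constant has the strictly smaller value, and products
    inherit this domination. *)
Lemma monomial_val_prod_far (rs : seq L) (P := \prod_(b <- rs) ('X - b%:P)) :
  extends polyC vbar wbar ->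
  (forall b, b \in rs -> vlt (vbar (alpha - b)) (Some delta)) ->
  exists g, [/\ vbar P.[alpha] = Some g, wbar P = Some g
              & vlt (Some g) (wbar (P - P.[alpha]%:P))].
Proof.
move=> wC; rewrite /P; elim: rs {P} => [_|b rs IHrs far].
  by exists 0; rewrite big_nil hornerC !val1 subrr val0.
have [|g [ug wg lt_g]] := IHrs; first by move=> c c_rs; apply: far; rewrite inE c_rs orbT.
have lt_b := far b (mem_head b rs); have [x bx] := vlt_fin lt_b.
rewrite big_cons hornerM !hornerE; set Q := \prod_(c <- rs) _ in ug wg lt_g *.
have wb : wbar ('X - b%:P) = Some x by rewrite monomial_val_XsubC /vmin vltW // bx.
exists (x + g); rewrite !valM wb wg bx ug; split=> //.
have -> : ('X - b%:P) * Q - ((alpha - b) * Q.[alpha])%:P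
    = ('X - alpha%:P) * Q + (alpha - b)%:P * (Q - Q.[alpha]%:P).
  by rewrite mulrBr addrA -mulrDl polyCM polyCB addrA subrK.
have wa : wbar ('X - alpha%:P) = Some delta by rewrite monomial_val_XsubC subrr val0.
apply: vlt_le_trans (valD wbar _ _); rewrite vlt_vmin !valM wC wg bx wa.
rewrite -[Some (x + g)]/(vadd (Some x) (Some g)); apply/andP; split.
  by rewrite vlt_addr -bx.
by rewrite ![vadd (Some x) _]vaddC vlt_addr.
Qed.

End MonomialValuation.

Section ProductOfConstants.
Variables (G : oagType) (L : fieldType) (vbar : valuation G L).
Variables (wbar : valuation G {poly L}).
Hypothesis wC : extends polyC vbar wbar.

Lemma val_prod_subC_ge (us : seq L) (P : {poly L}) g :
  wbar P = Some g -> (forall u, u \in us -> vbar u = Some g) ->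
  vle (vbar (\prod_(u <- us) - u)) (wbar (\prod_(u <- us) (P - u%:P))).
Proof.
move=> wP; elim: us => [_|u us IHus vus]; first by rewrite !big_nil !val1 vle_refl.
rewrite !big_cons !valM; apply: vle_add.
  apply: vle_trans (valB wbar _ _); rewrite vle_vmin wC wP valN (vus u) ?mem_head //.
  by rewrite vle_refl.
by apply: IHus => c c_us; apply: vus; rewrite inE c_us orbT.
Qed.

(** Each factor P - c has value at least [g], and the factor at [u] exceeds it. For [us] the roots
    of m, this makes m(P) negligible against m(0). *)
Lemma val_prod_subC_gt (us : seq L) (P : {poly L}) g u :
  wbar P = Some g -> (forall u, u \in us -> vbar u = Some g) ->
  u \in us -> vlt (Some g) (wbar (P - u%:P)) ->
  vlt (vbar (\prod_(u <- us) - u)) (wbar (\prod_(u <- us) (P - u%:P))).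
Proof.
move=> wP vus u_us lt_u; rewrite !(big_rem _ u_us) /= !valM valN (vus u) //.
have vrem c : c \in rem u us -> vbar c = Some g by move/mem_rem/vus.
have [x vx] : exists x, vbar (\prod_(c <- rem u us) - c) = Some x.
  elim: (rem u us) vrem => [_|c s IHs vs]; first by exists 0; rewrite big_nil val1.
  have [|x vx] := IHs; first by move=> d d_s; apply: vs; rewrite inE d_s orbT.
  by exists (g + x); rewrite big_cons valM valN vx (vs c) ?mem_head.
by apply: (vlt_le_add (x := x)) => //; apply: val_prod_subC_ge vrem.
Qed.

End ProductOfConstants.

(** * Conjugacy of common extensions *)

Section CommonExtensions.
Variables (G : oagType) (K : fieldType) (L : closedFieldType) (iota : {rmorphism K -> L}).
Hypothesis algL : forall z : L, algebraicOver iota z.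
Variables (vbar : valuation G L) (w : valuation G {poly K}).
Hypothesis w0 : trivial_support w.
Local Notation D := (in_decomposition_group iota vbar).

(** Taking [M] to be [L] makes common extensions conjugate under [D]; taking it to be [Kh]
    determines [wh]. *)
Lemma conjugate_common_extension (M : fieldType) (iM : {rmorphism K -> M}) (j : {rmorphism M -> L})
    (W : valuation G {poly M}) (wbar : valuation G {poly L}) :
  j \o iM =1 iota -> extends (map_poly iM) w W -> extends (map_poly iota) w wbar ->
  exists2 s : {rmorphism M -> L}, s \o iM =1 iota & forall f, W f = wbar (map_poly s f).
Proof.
move=> j_iM wW wwbar.
have algjM z : algebraicOver (j \o iM) z.
  by have [p p_nz pz] := algL z; exists p; rewrite ?(eq_map_poly j_iM).
have algM b : algebraicOver iM b.
  have [p p_nz] := algjM (j b).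
  by rewrite map_poly_comp fmorph_root => pb; exists p.
have W0 := trivial_support_algebraic algjM w0 wW.
have wbar0 : trivial_support wbar.
  exact: (trivial_support_algebraic (j := (idfun : {rmorphism L -> L})) algL w0 wwbar).
have agree f : W (map_poly iM f) = wbar (map_poly iota f) by rewrite wW wwbar.
exact: (conjugate_extension j algM I (trivial_support_coef W0)
  (trivial_support_coef wbar0) agree).
Qed.

Lemma common_extension_conjugate (wbar W : valuation G {poly L}) :
  common_extension iota w vbar wbar -> common_extension iota w vbar W ->
  exists2 s : {rmorphism L -> L}, D s & forall f, W f = wbar (map_poly s f).
Proof.
move=> [wwbar vwbar] [wW vW].
have id_iota : (idfun : {rmorphism L -> L}) \o iota =1 iota by [].
have [s si sW] := conjugate_common_extension id_iota wW wwbar.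
exists s => //; apply: isometry_decomposition si _ => // z.
by rewrite -(vW z) sW map_polyC /= vwbar.
Qed.

Lemma common_extension_comp (wbar : valuation G {poly L}) (s : {rmorphism L -> L}) :
  common_extension iota w vbar wbar -> D s ->
  common_extension iota w vbar (@comp_valuation G {poly L} {poly L} wbar (map_poly s)).
Proof.
move=> [wwbar vwbar] [_ si sv]; split=> [f|z] /=; last by rewrite map_polyC /= vwbar sv.
rewrite -map_poly_comp -wwbar; congr (wbar _).
by apply: eq_map_poly => a /=; rewrite si.
Qed.

Variables (Kh : fieldType) (ih : {rmorphism K -> Kh}) (jh : {rmorphism Kh -> L}).
Hypothesis jh_ih : jh \o ih =1 iota.
Hypothesis im_jh : range jh = henselization iota vbar.

Lemma henselian_extension_unique (wbar : valuation G {poly L}) (wh : valuation G {poly Kh}) :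
  common_extension iota w vbar wbar -> common_extension ih w (vbar \o jh) wh ->
  forall f, wh f = wbar (map_poly jh f).
Proof.
move=> [wwbar vwbar] [wwh vwh] f.
have [s si sW] := conjugate_common_extension jh_ih wwh wwbar.
have /(henselization_embedding algL jh_ih im_jh si) sj a : vbar (s a) = vbar (jh a).
  by rewrite -vwbar -map_polyC -sW vwh.
by rewrite sW (eq_map_poly sj).
Qed.

Section Monomial.
Variables (wbar : valuation G {poly L}) (alpha : L) (delta : G).
Hypothesis ext_wbar : common_extension iota w vbar wbar.
Hypothesis wbarE : wbar =1 monomial_val vbar alpha delta.

(** [W] is [wbar] composed with some [s] in [D], and the hypothesis puts [s b] in the ball around
    [alpha]. Recentring at [s b] and applying the isometry [s] gives the formula. *)
Lemma common_extension_XsubC (W : valuation G {poly L}) b z :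
  common_extension iota w vbar W -> W ('X - b%:P) = Some delta ->
  W ('X - z%:P) = vmin (vbar (b - z)) (Some delta).
Proof.
move=> ext_W; have [s Ds sW] := common_extension_conjugate ext_wbar ext_W.
have [_ _ sv] := Ds.
rewrite !sW !rmorphB /= !map_polyX !map_polyC /= => /eqP.
rewrite (monomial_val_XsubC_eq wbarE) val_distC => sb.
by rewrite (monomial_val_XsubC wbarE) (vmin_recenter _ sb) -rmorphB sv.
Qed.

Lemma common_extension_eq (W W' : valuation G {poly L}) b :
  common_extension iota w vbar W -> common_extension iota w vbar W' ->
  W ('X - b%:P) = Some delta -> W' ('X - b%:P) = Some delta -> W = W'.
Proof.
move=> extW extW' Wb W'b; apply: valuation_linear_ext => [a|z].
  by have [_ ->] := extW; have [_ ->] := extW'.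
by rewrite (common_extension_XsubC _ extW Wb) (common_extension_XsubC _ extW' W'b).
Qed.

Lemma count_close_roots (W : valuation G {poly L}) (rs : seq L) (fh : {poly Kh}) :
  common_extension iota w vbar W -> map_poly jh fh = \prod_(b <- rs) ('X - b%:P) ->
  count (fun b => W ('X - b%:P) == Some delta) rs
  = count (fun b => vle (Some delta) (vbar (b - alpha))) rs.
Proof.
move=> ext_W fh_rs; have [s Ds sW] := common_extension_conjugate ext_wbar ext_W.
have /permP perm_rs : perm_eq rs (map s rs).
  apply: prod_XsubC_eq; rewrite -fh_rs big_map -(map_prod_XsubC s) -fh_rs -map_poly_comp.
  by apply: eq_map_poly => a /=; rewrite (decomposition_fix im_jh).
rewrite [RHS]perm_rs count_map; apply: eq_count => b /=.
by rewrite sW rmorphB /= map_polyX map_polyC (monomial_val_XsubC_eq wbarE).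
Qed.

Variables (wh : valuation G {poly Kh}) (fh : {poly Kh}).
Hypothesis ext_wh : common_extension ih w (vbar \o jh) wh.
Hypotheses (monic_fh : fh \is monic) (irr_fh : irreducible_poly fh).
Hypothesis kp_fh : key_polynomial wh fh.

(* With all roots of fh far from alpha, fh and u = fh(alpha) have the same
   initial form; then m(fh), for m the minimal polynomial of u over Kh, is
   negligible against m(0), because the conjugates of u have the value of u. *)
Lemma close_root_exists : exists2 b, root (map_poly jh fh) b & vle (Some delta) (vbar (b - alpha)).
Proof.
apply: contrapT => no_close; have [wwbar vwbar] := ext_wbar.
have whE := henselian_extension_unique ext_wbar ext_wh.
have [size_fh _] := irr_fh.
apply: (key_polynomial_not_unit size_fh kp_fh).
have [rs] := closed_field_poly_normal (map_poly jh fh).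
rewrite lead_coef_map (monicP monic_fh) rmorph1 scale1r => fh_rs.
have far b : b \in rs -> vlt (vbar (alpha - b)) (Some delta).
  move=> b_rs; rewrite vltNge val_distC; apply/negP=> close; apply: no_close.
  by exists b => //; rewrite fh_rs root_prod_XsubC.
have := monomial_val_prod_far wbarE vwbar far; rewrite -fh_rs.
set u := (map_poly jh fh).[alpha] => -[g [vu wfh lt_u]].
have [m [mon_m irr_m root_m]] := minimal_poly_exists (algebraic_henselization algL jh_ih u).
apply: (@initial_unit_of_root _ _ _ _ m).
have [us] := closed_field_poly_normal (map_poly jh m).
rewrite lead_coef_map (monicP mon_m) rmorph1 scale1r => m_us.
have usE c : (c \in us) = root (map_poly jh m) c by rewrite m_us root_prod_XsubC.
(* The roots of [m] are conjugate under [D], which preserves [vbar]. *)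
have vus c : c \in us -> vbar c = Some g.
  rewrite usE => mc.
  have [|s [_ _ sv] <-] := decomposition_transitive algL im_jh (b := u) (b' := c).
    by move=> q; rewrite root_m => /dvdpP[q' ->]; rewrite rmorphM rootM mc orbT.
  by rewrite sv.
have u_us : u \in us by rewrite usE root_m dvdpp.
have m0E : map_poly jh (m.[0])%:P = (\prod_(c <- us) - c)%:P.
  rewrite map_polyC /= -[jh m.[0]]horner_map rmorph0 m_us horner_prod; congr _%:P.
  by apply: eq_bigr => c _; rewrite !hornerE.
have mfE : map_poly jh (m \Po fh) = \prod_(c <- us) (map_poly jh fh - c%:P).
  rewrite map_comp_poly m_us rmorph_prod; apply: eq_bigr => c _.
  by rewrite rmorphB /= comp_polyX comp_polyC.
rewrite !whE m0E mfE vwbar.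
by have := val_prod_subC_gt vwbar wfh vus u_us lt_u.
Qed.

(** Some [s] in [D] moves [b] to a close root, and [wbar] composed with [s] treats [b] as [wbar]
    treats that root. *)
Lemma close_conjugate_exists b : root (map_poly jh fh) b ->
  exists2 W, common_extension iota w vbar W & W ('X - b%:P) = Some delta.
Proof.
move=> fh_b; have [c fh_c close] := close_root_exists.
have [|s Ds sb] := decomposition_transitive algL im_jh (b := b) (b' := c).
  move=> q; apply: contraTT => qc; have : coprimep fh q.
    rewrite irreducible_poly_coprime //; apply: contra qc => /dvdpP[q' ->].
    by rewrite rmorphM rootM fh_c orbT.
  by rewrite -(coprimep_map jh) => /coprimep_root/(_ fh_b).
exists (@comp_valuation G {poly L} {poly L} wbar (map_poly s)).
  exact: common_extension_comp.
apply/eqP; rewrite /= rmorphB /= map_polyX map_polyC /= sb.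
by rewrite (monomial_val_XsubC_eq wbarE).
Qed.

End Monomial.
End CommonExtensions.

(** * The double count of roots and common extensions *)

Theorem theorem3p2 (G : oagType)
  (K : fieldType) (v : valuation G K)
  (* an algebraic closure L of K, and an extension of v to L *)
  (L : closedFieldType) (iota : {rmorphism K -> L})
  (algL : forall z : L, algebraicOver iota z)
  (vbar : valuation G L) (v_vbar : extends iota v vbar)
  (* the Henselization, as a field Kh between K and L *)
  (Kh : fieldType) (ih : {rmorphism K -> Kh}) (jh : {rmorphism Kh -> L})
  (jh_ih : jh \o ih =1 iota) (im_jh : range jh = henselization iota vbar)
  (* a valuation-transcendental extension of v, and its extension to Kh[x] *)
  (w : valuation G {poly K}) (v_w : extends polyC v w)
  (vt_w : valuation_transcendental v w)
  (wh : valuation G {poly Kh}) (ext_wh : common_extension ih w (vbar \o jh) wh)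
  (* a key polynomial f and its factor f^h *)
  (f : {poly K}) (kp_f : key_polynomial w f)
  (fh : {poly Kh}) (monic_fh : fh \is monic) (irr_fh : irreducible_poly fh)
  (fh_dvd : fh %| map_poly ih f) (kp_fh : key_polynomial wh fh)
  (unit_fh : initial_unit wh (map_poly ih f %/ fh))
  (* a pair defining a common extension, with respect to which j is computed *)
  (wbar : valuation G {poly L}) (ext_wbar : common_extension iota w vbar wbar)
  (alpha : L) (delta : G) (wbarE : wbar =1 monomial_val vbar alpha delta)
  (r : nat)
  (card_r : ([set W : valuation G {poly L} | common_extension iota w vbar W]
             #= `I_r)%card) :
  (r%:R : rat) =
    (size fh).-1%:R / (j_invariant vbar alpha delta (map_poly jh fh))%:R.
Proof.
have [w0 _] := vt_w.
pose rs := root_seq (map_poly jh fh).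
have fh_rs : map_poly jh fh = \prod_(b <- rs) ('X - b%:P).
  rewrite /rs /root_seq; case: closed_field_poly_normal => s /= {1}->.
  by rewrite lead_coef_map (monicP monic_fh) rmorph1 scale1r.
have size_rs : size rs = (size fh).-1.
  by rewrite -(size_map_poly jh) fh_rs size_prod_XsubC.
have rsE b : (b \in rs) = root (map_poly jh fh) b by rewrite fh_rs root_prod_XsubC.
set j := j_invariant vbar alpha delta (map_poly jh fh).
have [b0 fh_b0 close_b0] := close_root_exists algL w0 jh_ih im_jh ext_wbar wbarE
  ext_wh monic_fh irr_fh kp_fh.
(* Division by zero yields 0 in [rat], so the quotient has its meaning only once j is positive. *)
have j_gt0 : (0 < j)%N.
  by rewrite /j /j_invariant -has_count; apply/hasP; exists b0; rewrite // rsE.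
have [idx [idx_lt idx_inj idx_surj]] := card_set_bijP card_r.
have /choice[e eE] (i : 'I_r) : exists W, common_extension iota w vbar W /\ idx W = i.
  by have [W ? ?] := idx_surj i (ltn_ord i); exists W.
pose c i b := e i ('X - b%:P) == Some delta.
have countW i : count (c i) rs = j.
  exact: (count_close_roots algL w0 im_jh ext_wbar wbarE (eE i).1 fh_rs).
have count_root b : b \in rs -> (\sum_(i < r) c i b)%N = 1%N.
  rewrite rsE => fh_b.
  have [W extW Wb] := close_conjugate_exists algL w0 jh_ih im_jh ext_wbar wbarE
    ext_wh monic_fh irr_fh kp_fh fh_b.
  have lt_i : (idx W < r)%N by apply: idx_lt.
  pose i := Ordinal lt_i.
  have eW : e i = W.
    by apply: idx_inj; rewrite ?inE; [apply: (eE i).1 | | apply: (eE i).2].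
  rewrite (bigD1 i) //= /c eW Wb eqxx big1 // => k ki; apply/eqP; rewrite eqb0.
  apply: contra ki => /eqP kb; apply/eqP/val_inj => /=.
  rewrite -(eE k).2; congr idx.
  exact: (common_extension_eq algL w0 ext_wbar wbarE (eE k).1 extW kb Wb).
have rj : (r * j)%N = (size fh).-1.
  rewrite -size_rs -sum1_size -[RHS](eq_big_seq _ count_root) exchange_big /=.
  rewrite -[r in LHS]card_ord -sum_nat_const; apply: eq_bigr => i _.
  by rewrite -(countW i) -sum1_count big_mkcond.
by rewrite -rj natrM mulfK // Num.Theory.pnatr_eq0 -lt0n.
Qed.
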